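(* Let $f(S)=\frac12\sum_{u,v\in S}A(u,v)+\sum_{v\in S}b(v)$ for $S\subseteq[n]$, where $A\in\mathbb{R}^{n\times n}$ is symmetric with zero diagonal, $A\ge0$, $b\ge0$, and suppose its multilinear extension $F(x)=\frac12x^TAx+b^Tx$ is one-sided $\sigma$-smooth. Let $\mathcal{M}$ be a matroid on $[n]$ of rank $r$ with minimum circuit size $c$ and matroid polytope $P_{\mathcal M}$. Then there is a polynomial-time algorithm which, given $x^*\in P_{\mathcal M}$, produces an independent set $I$ of $\mathcal M$ (so $\mathbbm{1}_I\in P_{\mathcal M}$) such that \[ F(x^* )\le O\Big(\min\Big\{\frac{r}{c-2},\,1+\frac{\sigma}{r}\Big\}\Big)f(I)\le O(\sqrt{\sigma})\,f(I). \]
   Context: The multilinear extension of $f:2^{[n]}\to\mathbb R$ is $F(x)=\mathbb E[f(R(x))]$ where $R(x)$ contains each $i$ independently with probability $x_i$. $F$ is one-sided $\sigma$-smooth if for all $u,x\ge0$, $x\neq0$: $\frac12u^T\nabla^2F(x)u\le\sigma\frac{\|u\|_1}{\|x\|_1}u^T\nabla F(x)$. $P_{\mathcal M}$ is the convex hull of the characteristic vectors $\mathbbm 1_S$ of independent sets $S$ of $\mathcal M$. $\mathbbm1_I$ is the characteristic vector of $I$.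
   Formalization: Proved for c ≥ 3 (r/(c−2) is undefined at c = 2, negative at c = 1; for c = 2 the bound fails on U_{1,2}), and the O(√σ) bound is asserted for σ ≥ 1, which is automatic if A ≠ 0; for A = 0 and σ = 0 it is false. *)

(* Defs.v *)
From HB Require Import structures.
From mathcomp Require Import all_boot all_order all_algebra.
From mathcomp Require Import all_classical all_reals all_analysis.

Set Implicit Arguments.
Unset Strict Implicit.
Unset Printing Implicit Defensive.
Import Order.TTheory GRing.Theory Num.Theory.
Import numFieldNormedType.Exports.
Local Open Scope ring_scope.

Section SetFunctions.
Variables (R : realType) (n : nat).
Implicit Types (f : {set 'I_n} -> R) (F : 'cV[R]_n -> R) (x u : 'cV[R]_n).

Definition charvec (S : {set 'I_n}) : 'cV[R]_n := \col_i (i \in S)%:R.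

Definition quad_setfun (A : 'M[R]_n) (b : 'cV[R]_n) (S : {set 'I_n}) : R :=
  2^-1 * (\sum_(u in S) \sum_(v in S) A u v) + \sum_(v in S) b v 0.

(** [E[f(R(x))]], expanded over the values of the random set [R(x)]. The
    expression is a polynomial in [x]; smoothness below evaluates it on the
    whole nonnegative orthant, not only on the unit cube. *)
Definition multilinear f x : R :=
  \sum_(S : {set 'I_n})
     f S * ((\prod_(i in S) x i 0) * (\prod_(i in ~: S) (1 - x i 0))).

Definition partial (i : 'I_n) F : 'cV[R]_n -> R := 'D_(delta_mx i 0) F.

Definition gradient F x : 'cV[R]_n := \col_i partial i F x.

Definition hessian F x : 'M[R]_n := \matrix_(i, j) partial i (partial j F) x.

(** The canonical norm [`|x|] on matrices is the sup norm. *)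
Definition l1norm x : R := \sum_i `|x i 0|.

Definition nonneg x : Prop := forall i, 0 <= x i 0.

Definition one_sided_smooth (sigma : R) F : Prop :=
  forall u x, nonneg u -> nonneg x -> x != 0 ->
    2^-1 * (u^T *m hessian F x *m u) 0 0
      <= sigma * (l1norm u / l1norm x) * (u^T *m gradient F x) 0 0.

End SetFunctions.

Section MultilinearQuadratic.
Variables (R : realType) (n : nat).
Implicit Types (x : 'cV[R]_n) (S T : {set 'I_n}).

Let wt x S : R := (\prod_(i in S) x i 0) * (\prod_(i in ~: S) (1 - x i 0)).

Lemma sum_wt_supset x T :
  \sum_(S : {set 'I_n}) (T \subset S)%:R * wt x S = \prod_(i in T) x i 0.
Proof.
transitivity (\sum_(S : {set 'I_n}) (\prod_(i in S) x i 0) *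
                     \prod_(i in ~: S) ((i \notin T)%:R * (1 - x i 0))).
  apply: eq_bigr => S _; rewrite /wt big_split /= mulrCA; congr (_ * _).
  congr (_ * _); case: (boolP (T \subset S)) => [/fintype.subsetP sTS|/subsetPn[i iT iS]].
    by rewrite big1 // => i; rewrite inE => /(contra (sTS i)) ->.
  by rewrite (bigD1 i) ?inE //= iT mul0r.
transitivity (\prod_i (x i 0 + (i \notin T)%:R * (1 - x i 0))).
  rewrite bigA_distr; apply: eq_bigr => S _.
  rewrite [RHS](bigID (mem S)) /=; congr (_ * _).
    by apply: eq_bigr => i ->.
  by apply: eq_big => i; rewrite inE // => /negPf->.
rewrite [LHS](bigID (mem T)) /= [X in _ * X]big1 ?mulr1.
  by apply: eq_bigr => i ->; rewrite mul0r addr0.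
by move=> i ->; rewrite mul1r addrC subrK.
Qed.

Lemma multilinear_quad (A : 'M[R]_n) (b x : 'cV[R]_n) :
  (forall i, A i i = 0) ->
  multilinear (quad_setfun A b) x
    = 2^-1 * (x^T *m A *m x) 0 0 + (b^T *m x) 0 0.
Proof.
move=> A0; transitivity (\sum_(S : {set 'I_n}) (2^-1 * (\sum_u \sum_v A u v *
    (([set u; v] \subset S)%:R * wt x S))
    + \sum_v b v 0 * (([set v] \subset S)%:R * wt x S))).
  apply: eq_bigr => S _; rewrite -/(wt x S) mulrDl -mulrA; congr (_ * _ + _).
    rewrite mulr_suml big_mkcond; apply: eq_bigr => u _.
    case: ifP => uS; last first.
      by rewrite big1 // => v _; rewrite finset.subUset finset.sub1set uS mul0r mulr0.
    rewrite mulr_suml big_mkcond; apply: eq_bigr => v _.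
    rewrite finset.subUset !finset.sub1set uS /=.
    by case: ifP => _; rewrite ?mul1r // mul0r mulr0.
  rewrite mulr_suml big_mkcond; apply: eq_bigr => v _.
  by rewrite finset.sub1set; case: ifP => _; rewrite ?mul1r // mul0r mulr0.
rewrite big_split /= -mulr_sumr; congr (_ * _ + _).
  rewrite exchange_big /= mxE; under [RHS]eq_bigr do rewrite mxE mulr_suml.
  rewrite [RHS]exchange_big /=; apply: eq_bigr => u _.
  rewrite exchange_big /=; apply: eq_bigr => v _.
  rewrite -mulr_sumr sum_wt_supset mxE.
  have [<-|uv] := eqVneq u v; first by rewrite A0 !(mul0r, mulr0).
  by rewrite big_setU1 ?inE //= big_set1 mulrCA mulrA.
rewrite exchange_big /= mxE; apply: eq_bigr => v _.
by rewrite -mulr_sumr sum_wt_supset big_set1 mxE.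
Qed.

End MultilinearQuadratic.

Record matroid (n : nat) := Matroid {
  indep :> pred {set 'I_n};
  indep0 : indep finset.set0;
  indepS : forall S T : {set 'I_n}, S \subset T -> indep T -> indep S;
  indep_aug : forall S T : {set 'I_n}, indep S -> indep T -> (#|S| < #|T|)%N ->
    exists2 v, v \in T :\: S & indep (v |: S)
}.

Section Matroids.
Variables (n : nat) (M : matroid n).

Definition rank : nat := \max_(S : {set 'I_n} | indep M S) #|S|.

Definition circuit (C : {set 'I_n}) : bool := minset (fun S => ~~ indep M S) C.

Definition min_circuit_size (c : nat) : Prop :=
  (exists2 C, circuit C & #|C| = c) /\ (forall C, circuit C -> (c <= #|C|)%N).

End Matroids.

Definition convex_hull (R : realType) (V : lmodType R) (X : set V) : set V :=
  [set x | exists (m : nat) (w : 'I_m -> R) (p : 'I_m -> V),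
     [/\ forall i, 0 <= w i, \sum_i w i = 1, forall i, X (p i)
       & x = \sum_i w i *: p i]]%classic.

Definition matroid_polytope (R : realType) (n : nat) (M : matroid n) :
    set 'cV[R]_n :=
  convex_hull [set y | exists2 S, indep M S & y = charvec R S]%classic.
Arguments matroid_polytope R {n} M.

(** Structured programs for a real RAM with an independence oracle. A program
    is a finite object, independent of the ground set and of the reals. The
    memory consists of
    - natural-number registers, indexed by [nat];
    - arrays of bits, and arrays of real numbers; the pair [(a, i) : cell]
      denotes the entry of array [a] at the index stored in register [i].
    Every instruction, test and oracle query costs one time unit.
    Registers can only be reset, copied, incremented or set to [n], and real
    cells can be multiplied only by an entry of the input: after [t] steps a
    register is at most [n + t], and a real cell is an integer polynomial of
    degree at most [t] in the input with coefficients of absolute value at most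
    [2 ^ t] in sum. On rational inputs all numbers thus have polynomial bit
    length when [t] is polynomial, so that unit costs are legitimate. *)

Definition cell : Type := (nat * nat)%type.

Inductive test :=
| RegLt (i j : nat)
| BitOn (a : cell)
| RealLe (p q : cell)
| Indep (a : nat).

Inductive instr :=
| RegZero (i : nat)
| RegSize (i : nat)
| RegSucc (i : nat)
| RegCopy (i j : nat)
| BitSet (a : cell) (v : bool)
| RealZero (p : cell)
| RealOne (p : cell)
| RealCopy (p q : cell)
| RealAdd (p q : cell)
| RealSub (p q : cell)
| RealMulA (p : cell) (i j : nat)
| RealMulB (p : cell) (i : nat)
| RealMulX (p : cell) (i : nat).

Inductive prog :=
| Instr (c : instr)
| Seq (P Q : prog)
| If (t : test) (P Q : prog)
| While (t : test) (P : prog).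

Record state (R : Type) := State {
  reg : nat -> nat;
  bit : nat * nat -> bool;
  real : nat * nat -> R
}.

Definition init_state (R : realType) : state R :=
  State (fun=> 0%N) (fun=> false) (fun=> 0).

Definition upd (T : eqType) (U : Type) (g : T -> U) (k : T) (y : U) : T -> U :=
  fun l => if l == k then y else g l.

Section Semantics.
Variables (R : realType) (n : nat).
Variables (A : 'M[R]_n) (b x : 'cV[R]_n) (oracle : pred {set 'I_n}).
Implicit Types (s : state R).

(** Input entries; [0] outside the index range. *)
Definition entry2 (B : 'M[R]_n) (i j : nat) : R :=
  if (insub i, insub j) is (Some i', Some j') then B i' j' else 0.
Definition entry1 (y : 'cV[R]_n) (i : nat) : R :=
  if insub i is Some i' then y i' 0 else 0.

Definition addr s (p : cell) : nat * nat := (p.1, reg s p.2).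

Definition bitset s (a : nat) : {set 'I_n} :=
  [set v : 'I_n | bit s (a, nat_of_ord v)].

Definition eval_test s (t : test) : bool :=
  match t with
  | RegLt i j => (reg s i < reg s j)%N
  | BitOn a => bit s (addr s a)
  | RealLe p q => real s (addr s p) <= real s (addr s q)
  | Indep a => oracle (bitset s a)
  end.

Definition set_reg s i k := State (upd (reg s) i k) (bit s) (real s).
Definition set_bit s a v := State (reg s) (upd (bit s) (addr s a) v) (real s).
Definition set_real s p (y : R) :=
  State (reg s) (bit s) (upd (real s) (addr s p) y).

Definition eval_instr s (c : instr) : state R :=
  match c with
  | RegZero i => set_reg s i 0
  | RegSize i => set_reg s i n
  | RegSucc i => set_reg s i (reg s i).+1
  | RegCopy i j => set_reg s i (reg s j)
  | BitSet a v => set_bit s a v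
  | RealZero p => set_real s p 0
  | RealOne p => set_real s p 1
  | RealCopy p q => set_real s p (real s (addr s q))
  | RealAdd p q => set_real s p (real s (addr s p) + real s (addr s q))
  | RealSub p q => set_real s p (real s (addr s p) - real s (addr s q))
  | RealMulA p i j =>
      set_real s p (real s (addr s p) * entry2 A (reg s i) (reg s j))
  | RealMulB p i => set_real s p (real s (addr s p) * entry1 b (reg s i))
  | RealMulX p i => set_real s p (real s (addr s p) * entry1 x (reg s i))
  end.

(** [run P s s' t]: started in [s], [P] halts in [s'] after [t] time units. *)
Inductive run : prog -> state R -> state R -> nat -> Prop :=
| RunInstr c s : run (Instr c) s (eval_instr s c) 1
| RunSeq P Q s s1 s2 t1 t2 :
    run P s s1 t1 -> run Q s1 s2 t2 -> run (Seq P Q) s s2 (t1 + t2)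
| RunIf t P Q s s1 t1 :
    run (if eval_test s t then P else Q) s s1 t1 -> run (If t P Q) s s1 t1.+1
| RunWhileF t P s : ~~ eval_test s t -> run (While t P) s s 1
| RunWhileT t P s s1 s2 t1 t2 :
    eval_test s t -> run P s s1 t1 -> run (While t P) s1 s2 t2 ->
    run (While t P) s s2 (t1 + t2).+1.

(** On input [(n, A, b, x)] and the given oracle, [P] halts within [T] time
    units; the output is read off bit array [0]. *)
Definition outputs_within (P : prog) (T : nat) (I : {set 'I_n}) : Prop :=
  exists s t, [/\ run P (init_state R) s t, (t <= T)%N & bitset s 0 = I].

Lemma run_det P s s1 s2 t1 t2 :
  run P s s1 t1 -> run P s s2 t2 -> s1 = s2 /\ t1 = t2.
Proof.
move=> h; elim: h s2 t2 => {P s s1 t1}.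
- by move=> c s s2 t2 h; inversion h.
- move=> P Q s s1 s2 t1 t2 _ ih1 _ ih2 s3 t3 h.
  inversion h as [|P' Q' s' s1' s2' t1' t2' h1 h2| | |]; subst.
  by have [? ?] := ih1 _ _ h1; subst; have [-> ->] := ih2 _ _ h2.
- move=> t P Q s s1 t1 _ ih s2 t2 h.
  inversion h as [| |t' P' Q' s' s1' t1' h1| |]; subst.
  by have [-> ->] := ih _ _ h1.
- move=> t P s tN s2 t2 h.
  inversion h as [| | |t' P' s' tN'|t' P' s' s1' s2' t1' t2' tT]; subst => //.
  by rewrite tT in tN.
- move=> t P s s1 s2 t1 t2 tT _ ih1 _ ih2 s3 t3 h.
  inversion h as [| | |t' P' s' tN|t' P' s' s1' s2' t1' t2' tT' h1 h2]; subst.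
    by rewrite tT in tN.
  by have [? ?] := ih1 _ _ h1; subst; have [-> ->] := ih2 _ _ h2.
Qed.

End Semantics.

(* Main.v *)
Require Import Defs.
From HB Require Import structures.
From mathcomp Require Import all_boot all_order all_algebra.
From mathcomp Require Import all_classical all_reals all_analysis.
From mathcomp Require Import fintype finset ring lra.
Import Order.TTheory GRing.Theory Num.Theory.
Import numFieldNormedType.Exports.
Local Open Scope ring_scope.

Set Implicit Arguments.
Unset Strict Implicit.
Unset Printing Implicit Defensive.

(** With weights [w_y = A y + 2 b], let [J] be a base maximizing [w_x] and [I] one
    maximizing [w_(1_J)]; both are found greedily, without decomposing [x] into
    independent sets, and [F(x) <= A(I, J) + 2 b(I) + 2 b(J)]. The point
    [(1_I + 1_J) / 2] is then rounded by symmetric exchanges between the two bases: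
    exchanging [i] and [j] in the better direction costs at most [A i j / 4], so that
    the resulting base [K] has [4 f(K) >= A(I, J) - a], where [a] is the total weight of
    the exchanged pairs, a matching between [I] and [J]. There are two ways to pay
    for [a]. Smoothness at [1_(I - i)] in direction [e_i + e_j] and summation over the
    matching give [a <= O(sigma / r) (f(I) + f(J) + A(I, J) - a)]. On the other hand the
    matching splits into [O(r / (c - 2))] groups whose unions are independent, because a
    group is only closed when two more elements would make it dependent; the best
    group has value at least [a] divided by their number. The algorithm outputs the
    best of [I], [J], [K] and the groups. *)

(** * Matroids and the greedy algorithm *)

Section Bases.
Variables (n : nat) (M : matroid n).
Implicit Types (S T B : {set 'I_n}) (i j v : 'I_n).
Local Open Scope nat_scope.

Definition base B := indep M B && (#|B| == rank M).

Lemma base_indep B : base B -> indep M B.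
Proof. by case/andP. Qed.

Lemma card_base B : base B -> #|B| = rank M.
Proof. by case/andP=> _ /eqP. Qed.

Lemma indep_card_le S : indep M S -> #|S| <= rank M.
Proof. by move=> iS; apply: (leq_bigmax_cond (F := fun S : {set 'I_n} => #|S|)). Qed.

(** Iterated augmentation, by induction on [#|T| - #|S|]. The inclusion [S' \subset S :|: T] is kept
    so that an extension can later be compared with a given base. *)
Lemma indep_extend S T : indep M S -> indep M T -> #|S| <= #|T| ->
  exists S', [/\ indep M S', S \subset S', S' \subset S :|: T & #|S'| = #|T|].
Proof.
move=> iS iT; move: {2}(#|T| - #|S|) (erefl (#|T| - #|S|)) => k.
elim: k S iS => [|k IHk] S iS kE leST.
  exists S; split=> //; first exact: subsetUl.
  by apply/eqP; rewrite eqn_leq leST -subn_eq0 kE.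
have ltST : #|S| < #|T| by rewrite -subn_gt0 kE.
have [v /setDP[vT vS] ivS] := indep_aug iS iT ltST.
have cvS : #|v |: S| = #|S|.+1 by rewrite cardsU1 vS.
have [||S' [iS' sS' S'T cS']] := IHk _ ivS; rewrite ?cvS ?subnS ?kE //.
exists S'; split=> //; first exact: subset_trans (subsetUr _ _) sS'.
apply: subset_trans S'T _.
by rewrite !subUset subsetUl subsetUr sub1set inE vT orbT.
Qed.

Lemma exists_base : exists B, base B.
Proof.
rewrite /base /rank (bigop.bigmax_eq_arg finset.set0) ?indep0 //.
case: arg_maxnP => [|B iB _]; first exact: indep0.
by exists B; rewrite iB eqxx.
Qed.

Lemma indep_sub_base S : indep M S -> exists2 B, base B & S \subset B.
Proof.
move=> iS; have [B bB] := exists_base.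
have := indep_card_le iS; rewrite -(card_base bB) => leSB.
have [S' [iS' sS' _ cS']] := indep_extend iS (base_indep bB) leSB.
by exists S' => //; rewrite /base iS' cS' (card_base bB) eqxx.
Qed.

Lemma base_extend S B : indep M S -> base B ->
  exists B', [/\ base B', S \subset B' & B' \subset S :|: B].
Proof.
move=> iS bB; have leSB : #|S| <= #|B| by rewrite (card_base bB) indep_card_le.
have [B' [iB' sB' B'S cB']] := indep_extend iS (base_indep bB) leSB.
by exists B'; split=> //; rewrite /base iB' cB' (card_base bB) eqxx.
Qed.

(** By cardinality such a base misses exactly one element of [B]. This turns an extension given by
    [base_extend] into a swap of single elements. *)
Lemma base_subU1 B B' v : base B -> base B' -> v \notin B -> v \in B' ->
  B' \subset v |: B -> exists2 u, u \in B & B' = v |: (B :\ u).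
Proof.
move=> bB bB' vB vB' sB'.
have /subsetPn[u uB uB'] : ~~ (B \subset B').
  apply/negP=> sBB'; have : v |: B \subset B' by rewrite subUset sub1set vB'.
  by move/subset_leq_card; rewrite cardsU1 vB (card_base bB) (card_base bB') ltnn.
exists u => //; apply/eqP; rewrite eqEcard; apply/andP; split.
  apply/subsetP=> k kB'; rewrite !inE.
  have := subsetP sB' k kB'; rewrite !inE => /orP[->//|->].
  by rewrite andbT; apply/orP; right; apply: contraNneq uB' => <-.
rewrite cardsU1 !inE (negPf vB) andbF /= add1n.
by rewrite (card_base bB') -(card_base bB) (cardsD1 u B) uB.
Qed.

Lemma base_swap I i j : base I -> i \in I -> j \notin I ->
  indep M (j |: (I :\ i)) -> base (j |: (I :\ i)).
Proof.
move=> bI iI jI ind; rewrite /base ind cardsU1 !inE (negPf jI) andbF /=.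
by rewrite -(card_base bI) [in X in _ == X](cardsD1 i I) iI.
Qed.

(* [C] below is the fundamental circuit of [i] with respect to [J]. *)
Lemma symmetric_exchange I J i : base I -> base J -> i \in I :\: J ->
  exists2 j, j \in J :\: I & base (j |: (I :\ i)) && base (i |: (J :\ j)).
Proof.
move=> bI bJ /setDP[iI iJ].
pose C := [set j in J | indep M (i |: (J :\ j))].
have sCJ : C \subset J by apply/subsetP=> j; rewrite inE => /andP[].
have iC : indep M C by apply: (indepS sCJ); apply: base_indep.
(* Extending [i |: C] by elements of [J] would give a base [i |: (J :\ u)] containing [C]; then [u]
   lies in [C] by definition, although it has been removed. *)
have dC : ~~ indep M (i |: C).
  apply/negP=> iiC; have [Y [bY sY Ys]] := base_extend iiC bJ.
  have [||u uJ YE] := base_subU1 bJ bY iJ.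
  - by rewrite (subsetP sY) // !inE eqxx.
  - apply: subset_trans Ys _.
    by rewrite !subUset subsetUl subsetUr (subset_trans sCJ) // subsetUr.
  have uC : u \in C by rewrite inE uJ -YE base_indep.
  have : u \in Y by rewrite (subsetP sY) // in_setU1 uC orbT.
  by rewrite YE !inE eqxx /= orbF => /eqP ui; rewrite -ui uJ in iJ.
(* Here [C] is extended by elements of [I]. The base [Y] avoids [i] because [i |: C] is dependent,
   so augmenting [I :\ i] from [Y] must add an element of [C] outside [I]. *)
have [Y [bY sY Ys]] := base_extend iC bI.
have iY : i \notin Y.
  apply: contra dC => iY; apply: indepS (base_indep bY).
  by rewrite subUset sub1set iY.
have iIi : indep M (I :\ i) by apply: indepS (base_indep bI); apply: subD1set.
have [|j /setDP[jY jIi] ij] := indep_aug iIi (base_indep bY).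
  by rewrite (card_base bY) -(card_base bI) (cardsD1 i I) iI.
have ji : j != i by apply: contraNneq iY => <-.
have jI : j \notin I by move: jIi; rewrite !inE ji.
have jC : j \in C by have := subsetP Ys j jY; rewrite !inE (negPf jI) orbF.
have [jJ iJj] : j \in J /\ indep M (i |: (J :\ j)) by move: jC; rewrite inE => /andP.
exists j; first by rewrite inE jI.
by rewrite !base_swap.
Qed.

Section Circuits.
Variable c : nat.
Hypothesis cM : min_circuit_size M c.

Lemma dependent_card S : ~~ indep M S -> c <= #|S|.
Proof.
move=> dS; have [C cC sCS] := @minset_exists _ (fun S => ~~ indep M S) S dS.
exact: leq_trans (cM.2 C cC) (subset_leq_card sCS).
Qed.

(** A circuit becomes independent once an element is deleted. For [c > 2] this yields [rank M >= 2]
    and a ratio [r / (c - 2)] of at least 1. *)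
Lemma circuit_size_le_rank : c <= (rank M).+1.
Proof.
have [C /minsetP[dC mC] <-] := cM.1.
have [->|[v vC]] := set_0Vmem C; first by rewrite cards0.
have iC : indep M (C :\ v).
  apply: contraT => dCv; have := mC _ dCv (subD1set _ _).
  by move/setP/(_ v); rewrite !inE eqxx vC.
by rewrite (cardsD1 v) vC add1n ltnS indep_card_le.
Qed.
End Circuits.

End Bases.

Section Greedy.
Variables (R : realType) (n : nat) (M : matroid n) (w : 'I_n -> R).
Implicit Types (S B I P : {set 'I_n}) (v : 'I_n).

Definition max_base B :=
  base M B /\ forall S, base M S -> \sum_(v in S) w v <= \sum_(v in B) w v.

(* Every base can be replaced by one that is no lighter and agrees with the
   greedy choices [I] made on the processed elements [P]. *)
Definition greedy_inv I P := [/\ indep M I, I \subset P &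
  forall S, base M S -> exists B, [/\ base M B,
    \sum_(v in S) w v <= \sum_(v in B) w v, I \subset B & B :&: P \subset I]].

Lemma greedy_inv0 : greedy_inv set0 set0.
Proof.
split; rewrite ?indep0 ?sub0set // => S bS.
by exists S; split; rewrite ?sub0set ?setI0.
Qed.

(** If [v] is rejected, no base containing [I] contains [v], so [B] still serves. If [v] is accepted
    but missing from [B], then [v |: I] extends to [v |: (B :\ u)]; the lost [u] is outside [I],
    hence unprocessed, hence no heavier than [v]. *)
Lemma greedy_inv_step I P v : greedy_inv I P -> v \notin P ->
  (forall u, u \notin P -> w u <= w v) ->
  greedy_inv (if indep M (v |: I) then v |: I else I) (v |: P).
Proof.
move=> [iI sIP H] vP vmax; have vI : v \notin I by apply: contra (subsetP sIP v) vP.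
case: ifP => ivI; split=> //; first exact: setUS; last first.
- move=> S bS; have [B [bB lB sB sBP]] := H S bS.
  exists B; split=> //; apply/subsetP=> u /setIP[uB]; rewrite !inE.
  case/orP=> [/eqP uv|uP]; last by rewrite (subsetP sBP) // inE uB.
  case/negP: (negbT ivI); apply: indepS (base_indep bB).
  by rewrite subUset sB sub1set -uv uB.
- exact: subset_trans sIP (subsetUr _ _).
- move=> S bS; have [B [bB lB sB sBP]] := H S bS.
  have [vB|vB] := boolP (v \in B).
    exists B; split=> //; first by rewrite subUset sub1set vB.
    apply/subsetP=> u /setIP[uB]; rewrite !inE => /orP[->//|uP].
    by rewrite (subsetP sBP) ?orbT // inE uB.
  have [B' [bB' sB' B's]] := base_extend ivI bB.
  have vB' : v \in B' by rewrite (subsetP sB') // !inE eqxx.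
  have [|u uB BE] := base_subU1 bB bB' vB vB'.
    apply: subset_trans B's _; rewrite subUset subsetUr subUset subsetUl.
    by rewrite (subset_trans sB) // subsetUr.
  have uv : u != v by apply: contraNneq vB => <-.
  have uI : u \notin I.
    apply/negP=> uI; have : u \in B' by rewrite (subsetP sB') // !inE uI orbT.
    by rewrite BE !inE eqxx (negPf uv).
  have uP : u \notin P by apply: contra uI => uP; rewrite (subsetP sBP) // inE uB.
  exists B'; split=> //.
    apply: le_trans lB _; rewrite BE big_setU1 ?inE ?(negPf vB) ?andbF //=.
    by rewrite (big_setD1 u) //= lerD2r vmax.
  apply/subsetP=> k /setIP[]; rewrite BE !inE => /orP[->//|/andP[_ kB]].
  by case/orP=> [->//|kP]; rewrite (subsetP sBP) ?orbT // inE kB.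
Qed.

Lemma greedy_invT I : greedy_inv I [set: 'I_n] -> max_base I.
Proof.
move=> [_ _ H].
have E S : base M S -> base M I /\ \sum_(v in S) w v <= \sum_(v in I) w v.
  move=> bS; have [B [bB lB sB]] := H S bS; rewrite setIT => sBI.
  by have <- : B = I by apply/eqP; rewrite eqEsubset sBI.
split=> [|S /E[]//]; have [S /E[]//] := exists_base M.
Qed.

(** A linear function on a convex hull is bounded by its values at the generators; nonnegative
    weights allow each independent set to be enlarged to a base. *)
Lemma max_base_polytope B (x : 'cV[R]_n) : max_base B -> (forall v, 0 <= w v) ->
  matroid_polytope R M x -> \sum_v w v * x v 0 <= \sum_(v in B) w v.
Proof.
move=> [bB mB] w0 [m [l [p [l0 l1 pS ->]]]].
have -> : \sum_v w v * (\sum_i l i *: p i) v 0 =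
          \sum_i l i * (\sum_v w v * p i v 0).
  under eq_bigr do rewrite summxE mulr_sumr.
  rewrite exchange_big; apply: eq_bigr => i _; rewrite mulr_sumr.
  by apply: eq_bigr => v _; rewrite mxE mulrCA.
rewrite -[leRHS]mul1r -l1 mulr_suml; apply: ler_sum => i _.
apply: ler_wpM2l => //; have [S iS ->] := pS i.
have [B' bB' sSB'] := indep_sub_base iS; apply: le_trans (mB _ bB').
rewrite [leRHS]big_mkcond; apply: ler_sum => v _; rewrite mxE.
have [vS|vS] := boolP (v \in S); first by rewrite (subsetP sSB') // mulr1.
by rewrite mulr0; case: ifP.
Qed.
End Greedy.

Lemma charvec_polytope (R : realType) n (M : matroid n) I : indep M I ->
  matroid_polytope R M (charvec R I).
Proof.
move=> iI; exists 1%N, (fun=> 1), (fun=> charvec R I).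
by split=> //; rewrite ?big_ord1 ?scale1r // => _; exists I.
Qed.

Lemma polytope_nonneg (R : realType) n (M : matroid n) (x : 'cV[R]_n) :
  matroid_polytope R M x -> nonneg x.
Proof.
move=> [m [l [p [l0 _ pS ->]]]] v; rewrite summxE; apply: sumr_ge0 => i _.
by have [S _ ->] := pS i; rewrite !mxE mulr_ge0.
Qed.

(** * The quadratic function and smoothness *)

Section Charvec.
Variables (R : realType) (n : nat).
Implicit Types (S : {set 'I_n}) (v : 'I_n).
Local Notation "1_ S" := (charvec R S) (at level 8, format "1_ S").
Local Notation e_ v := (delta_mx v 0 : 'cV[R]_n).

Lemma charvecU1 S v : v \notin S -> 1_(v |: S) = 1_S + e_ v.
Proof.
move=> vS; apply/colP=> u; rewrite !mxE !inE eqxx andbT.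
by have [->|_] := eqVneq u v; rewrite ?(negPf vS) ?add0r ?addr0.
Qed.

Lemma charvecD1 S v : v \in S -> 1_(S :\ v) = 1_S - e_ v.
Proof.
move=> vS; rewrite -{2}(setD1K vS) charvecU1 ?addrK //.
by rewrite !inE eqxx.
Qed.

Lemma charvec_nonneg S : nonneg 1_S.
Proof. by move=> v; rewrite mxE ler0n. Qed.

Lemma l1norm_charvec S : l1norm 1_S = #|S|%:R.
Proof.
rewrite /l1norm -sum1_card natr_sum [RHS]big_mkcond; apply: eq_bigr => v _.
by rewrite mxE normr_nat; case: (v \in S).
Qed.

End Charvec.

Section Quadratic.
Variables (R : realType) (n : nat) (A : 'M[R]_n) (b : 'cV[R]_n).
Implicit Types (S I J U : {set 'I_n}) (i j v : 'I_n) (u x y z : 'cV[R]_n).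
Local Notation "1_ S" := (charvec R S) (at level 8, format "1_ S").
Local Notation e_ v := (delta_mx v 0 : 'cV[R]_n).
Local Notation f := (quad_setfun A b).

Definition bil u y : R := (u^T *m A *m y) 0 0.
Definition lin u : R := (b^T *m u) 0 0.
(** Twice the gradient of [F] at [y / 2]. With this scaling the weights of [1_S] sum over [S] to
    [2 f(S)], so a program without division can compare values of [f]. *)
Definition weight y i : R := \sum_j A i j * y j 0 + 2 * b i 0.

Lemma bilDl u1 u2 y : bil (u1 + u2) y = bil u1 y + bil u2 y.
Proof. by rewrite /bil linearD /= !mulmxDl mxE. Qed.
Lemma bilDr u y1 y2 : bil u (y1 + y2) = bil u y1 + bil u y2.
Proof. by rewrite /bil mulmxDr mxE. Qed.
Lemma bilNl u y : bil (- u) y = - bil u y.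
Proof. by rewrite /bil linearN /= !mulNmx mxE. Qed.
Lemma bilNr u y : bil u (- y) = - bil u y.
Proof. by rewrite /bil mulmxN mxE. Qed.
Lemma bilZl a u y : bil (a *: u) y = a * bil u y.
Proof. by rewrite /bil linearZ /= -!scalemxAl mxE. Qed.
Lemma bilZr a u y : bil u (a *: y) = a * bil u y.
Proof. by rewrite /bil -scalemxAr mxE. Qed.
Lemma linD u y : lin (u + y) = lin u + lin y.
Proof. by rewrite /lin mulmxDr mxE. Qed.
Lemma linN u : lin (- u) = - lin u.
Proof. by rewrite /lin mulmxN mxE. Qed.
Lemma linZ a u : lin (a *: u) = a * lin u.
Proof. by rewrite /lin -scalemxAr mxE. Qed.

Lemma bilE u y : bil u y = \sum_i u i 0 * \sum_j A i j * y j 0.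
Proof. by rewrite /bil -mulmxA mxE; apply: eq_bigr => i _; rewrite !mxE. Qed.
Lemma linE u : lin u = \sum_i b i 0 * u i 0.
Proof. by rewrite /lin mxE; apply: eq_bigr => i _; rewrite !mxE. Qed.

Lemma sum_delta (g : 'I_n -> R) i : \sum_j g j * e_ i j 0 = g i.
Proof.
rewrite (bigD1 i) //= mxE !eqxx mulr1 big1 ?addr0 // => j ji.
by rewrite mxE (negPf ji) mulr0.
Qed.

Lemma bil_deltal i y : bil (e_ i) y = \sum_j A i j * y j 0.
Proof.
rewrite bilE -[RHS](sum_delta (fun i => \sum_j A i j * y j 0)).
by apply: eq_bigr => j _; rewrite mulrC.
Qed.
Lemma bil_delta i j : bil (e_ i) (e_ j) = A i j.
Proof. by rewrite bil_deltal sum_delta. Qed.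
Lemma lin_delta i : lin (e_ i) = b i 0.
Proof. by rewrite linE sum_delta. Qed.

Lemma weightE y i : weight y i = bil (e_ i) y + 2 * lin (e_ i).
Proof. by rewrite bil_deltal lin_delta. Qed.

Lemma sum_weight y u : \sum_i weight y i * u i 0 = bil u y + 2 * lin u.
Proof.
rewrite bilE linE mulr_sumr -big_split; apply: eq_bigr => i _ /=.
by rewrite mulrDl [_ * u i 0]mulrC mulrA.
Qed.

Lemma sum_in_charvec (g : 'I_n -> R) S : \sum_(i in S) g i = \sum_i g i * 1_S i 0.
Proof.
rewrite big_mkcond; apply: eq_bigr => i _; rewrite mxE.
by case: (i \in S); rewrite ?mulr1 ?mulr0.
Qed.

Lemma sum_weight_in y S : \sum_(i in S) weight y i = bil 1_S y + 2 * lin 1_S.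
Proof. by rewrite sum_in_charvec sum_weight. Qed.

Lemma quad_setfunE S : f S = 2^-1 * bil 1_S 1_S + lin 1_S.
Proof.
rewrite /quad_setfun bilE linE -sum_in_charvec; congr (_ * _ + _).
rewrite sum_in_charvec; apply: eq_bigr => i _.
by rewrite mulrC sum_in_charvec.
Qed.

Lemma sum_weight_self S : \sum_(i in S) weight 1_S i = 2 * f S.
Proof. by rewrite sum_weight_in quad_setfunE; field. Qed.

Lemma quad_setfun0 : f set0 = 0.
Proof. by rewrite /quad_setfun !big_set0 mulr0 addr0. Qed.

Hypothesis symA : A^T = A.
Lemma bilC u y : bil u y = bil y u.
Proof.
transitivity ((u^T *m A *m y)^T 0 0); first by rewrite mxE.
by rewrite !trmx_mul trmxK symA mulmxA.
Qed.

Hypothesis diagA : forall i, A i i = 0.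

(** The difference quotient is constant for nonzero [h], so its limit is immediate. *)
Lemma derive_affine (G : 'cV[R]_n -> R) u x (L : R) :
  (forall h : R, G (h *: u + x) = G x + h * L) -> 'D_u G x = L.
Proof.
move=> GE; rewrite /derive; apply: lim_near_cst => //.
near=> h; rewrite /= GE addrAC subrr add0r /GRing.scale /= mulrA mulVf ?mul1r //.
by near: h; exact: nbhs_dnbhs_neq.
Unshelve. all: by end_near. Qed.

Lemma multilinearE x : multilinear f x = 2^-1 * bil x x + lin x.
Proof. exact: multilinear_quad. Qed.

(** The quadratic term [h ^ 2 * A i i] vanishes, so [F] is affine along each coordinate
    direction. *)
Lemma partial_multilinear i x : partial i (multilinear f) x = bil (e_ i) x + b i 0.
Proof.
apply: derive_affine => h; rewrite !multilinearE !(bilDl, bilDr, bilZl, bilZr).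
rewrite linD linZ bil_delta diagA lin_delta (bilC x (e_ i)).
by field.
Qed.

Lemma gradient_multilinear u x :
  (u^T *m gradient (multilinear f) x) 0 0 = bil u x + lin u.
Proof.
rewrite mxE bilE linE -big_split; apply: eq_bigr => i _ /=.
by rewrite !mxE partial_multilinear bil_deltal mulrDr [b i 0 * _]mulrC.
Qed.

Lemma hessian_multilinear x : hessian (multilinear f) x = A.
Proof.
apply/matrixP=> i j; rewrite mxE; apply: derive_affine => h.
rewrite !partial_multilinear bilDr bilZr bil_delta -[in A j i]symA mxE.
by ring.
Qed.

Hypothesis geA0 : forall i j, 0 <= A i j.
Hypothesis geb0 : forall i, 0 <= b i 0.

Lemma bil_ge0 u y : nonneg u -> nonneg y -> 0 <= bil u y.
Proof.
move=> u0 y0; rewrite bilE; apply: sumr_ge0 => i _; apply: mulr_ge0 => //.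
by apply: sumr_ge0 => j _; apply: mulr_ge0.
Qed.

Lemma lin_ge0 u : nonneg u -> 0 <= lin u.
Proof. by move=> u0; rewrite linE; apply: sumr_ge0 => i _; apply: mulr_ge0. Qed.

Lemma delta_nonneg i : nonneg (e_ i).
Proof. by move=> j; rewrite mxE ler0n. Qed.

Lemma weight_ge0 y i : nonneg y -> 0 <= weight y i.
Proof.
move=> y0; rewrite weightE addr_ge0 ?mulr_ge0 ?bil_ge0 ?lin_ge0 //; exact: delta_nonneg.
Qed.

Lemma quad_setfun_ge0 S : 0 <= f S.
Proof.
rewrite quad_setfunE addr_ge0 ?mulr_ge0 ?invr_ge0 ?bil_ge0 ?lin_ge0 //;
exact: charvec_nonneg.
Qed.

Lemma quad_setfun_add_pair U i j : i \notin U -> j \notin U -> i != j ->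
  f U + A i j <= f (i |: (j |: U)).
Proof.
move=> iU jU ij; rewrite !quad_setfunE !charvecU1 ?inE ?negb_or ?ij //.
rewrite !(bilDl, bilDr, linD) !bil_delta !diagA.
have := bil_ge0 (delta_nonneg i) (@charvec_nonneg R n U).
have := bil_ge0 (delta_nonneg j) (@charvec_nonneg R n U).
have := lin_ge0 (delta_nonneg i); have := lin_ge0 (delta_nonneg j).
have -> : A j i = A i j by rewrite -[in LHS]symA mxE.
by rewrite (bilC 1_U (e_ i)) (bilC 1_U (e_ j)); lra.
Qed.

Section Smoothness.
Variable sigma : R.
Hypothesis smoothF : one_sided_smooth sigma (multilinear f).

Lemma smooth_bil u x : nonneg u -> nonneg x -> x != 0 ->
  2^-1 * bil u u <= sigma * (l1norm u / l1norm x) * (bil u x + lin u).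
Proof.
move=> u0 x0 xn0; have := smoothF u0 x0 xn0.
by rewrite hessian_multilinear gradient_multilinear.
Qed.

Lemma l1norm_delta i : l1norm (e_ i) = 1.
Proof.
rewrite -[RHS](sum_delta (fun=> 1) i); apply: eq_bigr => j _.
by rewrite mul1r ger0_norm // delta_nonneg.
Qed.

Lemma delta_neq0 i : e_ i != 0.
Proof. by apply/eqP=> /colP/(_ i); rewrite !mxE !eqxx => /eqP; rewrite oner_eq0. Qed.

(** Smoothness at [u = e_i] and [x = e_j] has left side 0, so a negative [sigma] forces the gradient
    entry [A i j + b i] to be at most 0. This settles the degenerate case in which the constant from
    [smooth_pair] would be negative. *)
Lemma smooth_lt0 : sigma < 0 -> (forall i j, A i j = 0) /\ (forall i, b i 0 = 0).
Proof.
move=> s0; have H i j : A i j + b i 0 <= 0.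
  have := smooth_bil (delta_nonneg i) (delta_nonneg j) (delta_neq0 j).
  rewrite !l1norm_delta divr1 mulr1 !bil_delta diagA mulr0 lin_delta.
  by rewrite nmulr_rge0.
split=> [i j|i]; apply/eqP; rewrite eq_le ?geA0 ?geb0 andbT.
  by have := H i j; have := geb0 i; lra.
by have := H i i; have := geA0 i i; lra.
Qed.

(* The smoothness inequality at [u = e_i + e_j] and [x = 1_(I - i)]: deleting [i]
   is what produces the term [- A i j] on the right. *)
Lemma smooth_pair I i j : (1 < #|I|)%N -> i \in I ->
  A i j <= sigma * (2 / (#|I|%:R - 1)) *
    (bil (e_ i) 1_I + b i 0 + (bil (e_ j) 1_I + b j 0) - A i j).
Proof.
move=> I1 iI; have cI : #|I :\ i| = #|I|.-1 by rewrite (cardsD1 i I) iI.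
have u0 : nonneg (e_ i + e_ j) by move=> k; rewrite mxE addr_ge0 // delta_nonneg.
(* Smoothness is only available at nonzero points; this is where [#|I| > 1] enters. *)
have x0 : 1_(I :\ i) != 0.
  apply/eqP=> E; have := l1norm_charvec R (I :\ i); rewrite E cI /l1norm.
  rewrite big1 => [|k _]; last by rewrite mxE normr0.
  move/esym/eqP; rewrite pnatr_eq0; case: #|I| I1 => [|[|k]] //.
have := smooth_bil u0 (@charvec_nonneg R n _) x0.
have -> : l1norm (e_ i + e_ j) = 2.
  have -> : l1norm (e_ i + e_ j) = l1norm (e_ i) + l1norm (e_ j).
    rewrite /l1norm -big_split; apply: eq_bigr => k _ /=.
    by rewrite ger0_norm // mxE !ger0_norm ?delta_nonneg.
  by rewrite !l1norm_delta.
rewrite l1norm_charvec cI -subn1 natrB ?(ltnW I1) // charvecD1 //.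
(* With zero diagonal the form at [e_i + e_j] is [2 * A i j], and half of it is the left side. *)
rewrite !(bilDl, bilDr, bilNr, linD) !bil_delta !diagA !lin_delta.
have -> : A j i = A i j by rewrite -[in LHS]symA mxE.
by congr (_ <= _); [field | ring].
Qed.
End Smoothness.

End Quadratic.

(** * Swap rounding *)

Section SwapRounding.
Variables (R : realType) (n : nat) (A : 'M[R]_n) (b : 'cV[R]_n).
Variables (M : matroid n) (c : nat) (I0 J0 : {set 'I_n}) (K : R).
Implicit Types (S I J U : {set 'I_n}) (i j v : 'I_n) (z : 'cV[R]_n) (V : R).
Local Notation "1_ S" := (charvec R S) (at level 8, format "1_ S").
Local Notation e_ v := (delta_mx v 0 : 'cV[R]_n).
Local Notation f := (quad_setfun A b).
Local Notation bil := (bil A).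
Local Notation lin := (lin b).
Local Notation weight := (weight A b).

Hypothesis symA : A^T = A.
Hypothesis diagA : forall i, A i i = 0.
Hypothesis geA0 : forall i j, 0 <= A i j.
Hypothesis geb0 : forall i, 0 <= b i 0.
Hypothesis cM : min_circuit_size M c.
Hypothesis c_gt2 : (2 < c)%N.
Hypothesis bI0 : base M I0.
Hypothesis bJ0 : base M J0.
Hypothesis K_ge0 : 0 <= K.

(** The gradient of [F] at [1_I0]. Keeping the base point fixed lets the bounds for successive pairs
    be added up while the current bases change. *)
Let g i := bil (e_ i) 1_I0 + b i 0.

Hypothesis pairK : forall i j, i \in I0 -> A i j <= K * (g i + g j - A i j).

(* Eight times the multilinear extension at [z / 2]. *)
Definition energy z := bil z z + 4 * lin z.

(** Exact second-order expansion. Exchanging the roles of [i] and [j] flips the sign of the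
    first-order term, so the better direction loses at most [2 * A i j]. *)
Lemma energy_swap z i j :
  energy (z + e_ j - e_ i) = energy z + 2 * (weight z j - weight z i) - 2 * A i j.
Proof.
rewrite /energy !weightE !(bilDl, bilDr, bilNl, bilNr, linD, linN) !bil_delta.
rewrite !diagA (bilC symA z (e_ i)) (bilC symA z (e_ j)).
have -> : A j i = A i j by rewrite -[in LHS]symA mxE.
by ring.
Qed.

Lemma energy_charvec S : energy (1_S + 1_S) = 8 * f S.
Proof. by rewrite /energy quad_setfunE !(bilDl, bilDr, linD); field. Qed.

(** The test picks the direction in which the first-order term of [energy_swap] is nonnegative. *)
Definition swap_bases I J i j : {set 'I_n} * {set 'I_n} :=
  if weight (1_I + 1_J) i <= weight (1_I + 1_J) j
  then (j |: (I :\ i), J) else (I, i |: (J :\ j)).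

(** When the group overflows, a new one is started from the pair alone, which is independent because
    circuits have more than two elements. *)
Definition extend_group U i j :=
  if indep M (i |: (j |: U)) then i |: (j |: U) else [set i; j].

(* [a] is the total weight of the pairs swapped so far, [X] and [Y] are the sets
   of their first and second elements, [au] is the weight of the pairs in the
   current group [U] and [m] is the number of earlier groups, each of which has
   at least [c - 2] elements. *)
Inductive swap_inv I J U V : Prop :=
  SwapInv (a au : R) (m : nat) (X Y : {set 'I_n}) of
    base M I & base M J
  & energy (1_I0 + 1_J0) <= energy (1_I + 1_J) + 2 * a
  & X \subset I0 & Y \subset J0
  & I :\: J \subset I0 :\: X & J :\: I \subset J0 :\: Y
  & (forall v, v \in U -> (v \in I) = (v \in J))
  & a <= K * (\sum_(i in X) g i + \sum_(j in Y) g j - a)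
  & indep M U & au <= f U & f U <= V & a - au <= m%:R * V
  & (m * (c - 2) + #|U| <= 2 * #|X|)%N.

Lemma swap_inv0 V : 0 <= V -> swap_inv I0 J0 set0 V.
Proof.
move=> V0; apply: (@SwapInv _ _ _ _ 0 0 0%N set0 set0) => //.
- by rewrite mulr0 addr0.
- exact: sub0set.
- exact: sub0set.
- by rewrite setD0 subsetDl.
- by rewrite setD0 subsetDl.
- by move=> v; rewrite inE.
- by rewrite !big_set0 addr0 subr0 mulr0.
- exact: indep0.
- by rewrite quad_setfun0.
- by rewrite quad_setfun0.
- by rewrite subr0 mul0r.
- by rewrite cards0.
Qed.

(** Either direction makes the two bases agree on both [i] and [j], so the differences shrink
    whichever one is chosen. *)
Lemma swap_bases_diff I J i j : i \in I :\: J -> j \in J :\: I ->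
  let IJ := swap_bases I J i j in
  IJ.1 :\: IJ.2 = (I :\: J) :\ i /\ IJ.2 :\: IJ.1 = (J :\: I) :\ j.
Proof.
move=> /setDP[iI iJ] /setDP[jJ jI] /=; rewrite /swap_bases.
case: ifP => _ /=; split; apply/setP => v; rewrite !inE.
- have [->|vj] := eqVneq v j; first by rewrite jJ !andbF.
  by case: (v == i); rewrite /= ?andbF.
- have [->|vj] := eqVneq v j; rewrite /= ?andbF //.
  by have [->|vi] := eqVneq v i; rewrite /= ?(negPf iJ) ?andbF.
- have [->|vi] := eqVneq v i; rewrite /= ?andbF //.
  by have [->|vj] := eqVneq v j; rewrite /= ?(negPf jI) ?andbF.
- have [->|vi] := eqVneq v i; first by rewrite iI !andbF.
  by case: (v == j); rewrite /= ?andbF.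
Qed.

Lemma energy_swap_bases I J i j : i \in I :\: J -> j \in J :\: I ->
  let IJ := swap_bases I J i j in
  energy (1_I + 1_J) - 2 * A i j <= energy (1_(IJ.1) + 1_(IJ.2)).
Proof.
move=> /setDP[iI iJ] /setDP[jJ jI] /=; rewrite /swap_bases.
have jIi : j \notin I :\ i by rewrite !inE (negPf jI) andbF.
have iJj : i \notin J :\ j by rewrite !inE (negPf iJ) andbF.
set z := 1_I + 1_J; case: ifP => [wij|/negbT]; last rewrite -ltNge => /ltW wji.
all: rewrite /= charvecU1 // charvecD1 //.
  have -> : 1_I - e_ i + e_ j + 1_J = z + e_ j - e_ i.
    by rewrite /z addrAC (addrAC (1_I)) -!addrA; congr (_ + (_ + _)); rewrite addrC.
  by rewrite energy_swap; lra.
have -> : 1_I + (1_J - e_ j + e_ i) = z + e_ i - e_ j by rewrite /z addrAC !addrA.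
have -> : A i j = A j i by rewrite -[in LHS]symA mxE.
by rewrite energy_swap; lra.
Qed.

Lemma agree_notin I J U i : (forall v, v \in U -> (v \in I) = (v \in J)) ->
  i \in I :\: J -> i \notin U.
Proof. by move=> UP /setDP[iI iJ]; apply: contra iJ => /UP <-. Qed.

Lemma extend_groupP U i j : indep M U -> i \notin U -> j \notin U -> i != j ->
  [/\ indep M (extend_group U i j),
      (forall v, v \in extend_group U i j -> [|| v == i, v == j | v \in U]) &
      [/\ (#|extend_group U i j| = #|U| + 2)%N & f U + A i j <= f (extend_group U i j)]
      \/ [/\ (#|extend_group U i j| = 2)%N, (c - 2 <= #|U|)%N
           & A i j <= f (extend_group U i j)]].
Proof.
move=> iU iNU jNU ij; have cU : #|i |: (j |: U)| = (#|U| + 2)%N.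
  by rewrite !cardsU1 !inE negb_or ij iNU jNU addn2.
rewrite /extend_group; case: ifP => [iijU|/negbT dU]; split=> //.
- by move=> v; rewrite !inE.
- by left; split=> //; apply: quad_setfun_add_pair.
- apply: contraLR c_gt2 => /(dependent_card cM).
  by rewrite cards2 ij -leqNgt.
- by move=> v; rewrite !inE => /orP[]->; rewrite ?orbT.
- right; rewrite cards2 ij; split=> //.
    by have := dependent_card cM dU; rewrite cU leq_subLR addnC.
  have := @quad_setfun_add_pair _ _ A b symA diagA geA0 geb0 set0 i j.
  by rewrite quad_setfun0 add0r setU0 !inE; apply.
Qed.

Lemma swap_inv_step I J U V V' i j : swap_inv I J U V ->
  i \in I :\: J -> j \in J :\: I ->
  base M (j |: (I :\ i)) -> base M (i |: (J :\ j)) ->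
  V <= V' -> f (extend_group U i j) <= V' ->
  let IJ := swap_bases I J i j in swap_inv IJ.1 IJ.2 (extend_group U i j) V'.
Proof.
move=> [a au m X Y bI bJ He XI YJ IX JY UP Ka iU fau fV aV mU] iIJ jJI bI' bJ' VV' fU' IJ.
have [dI dJ] := swap_bases_diff iIJ jJI; rewrite -/IJ in dI dJ.
have /setDP[iI0 iX] := subsetP IX _ iIJ.
have /setDP[jJ0 jY] := subsetP JY _ jJI.
have iNU : i \notin U by apply: (agree_notin UP).
have jNU : j \notin U by apply: (@agree_notin J I) => // v /UP.
have ij : i != j by apply: contraTneq iIJ => ->; case/setDP: jJI => jJ _; rewrite inE jJ.
have [iU' U'P U'c] := extend_groupP iU iNU jNU ij.
have cX : #|i |: X| = #|X|.+1 by rewrite cardsU1 iX.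
have V0 : 0 <= V by apply: le_trans fV; apply: quad_setfun_ge0.
(* If the group is extended, its weight grows by [A i j]. If it is closed, its weight
   [au <= f U <= V] is charged to one more unit of [m], and the current weight restarts at
   [A i j]. *)
have [m' [au' [aV'' mU' fau']]] : exists m', exists au' : R,
   [/\ a + A i j - au' <= m'%:R * V',
      (m' * (c - 2) + #|extend_group U i j| <= 2 * #|i |: X|)%N &
      au' <= f (extend_group U i j)].
  have mVV' : m%:R * V <= m%:R * V' by rewrite ler_wpM2l.
  case: U'c => [[cU' fE]|[cU' cU fE]].
    exists m, (au + A i j); split; [by lra| |by lra].
    by rewrite cU' cX addnA mulnS addnC leq_add2l.
  exists m.+1, (A i j); split=> //.
    by rewrite -natr1 mulrDl mul1r; lra.
  (* The closed group pays [c - 2] for the increment of [m]; the new pair adds 2 to both sides. *)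
  rewrite cU' cX mulnS addnC leq_add2l mulSn addnC.
  by apply: leq_trans mU; rewrite leq_add2l.
apply: (@SwapInv _ _ _ _ (a + A i j) au' m' (i |: X) (j |: Y)) => //.
- by rewrite /IJ /swap_bases; case: ifP.
- by rewrite /IJ /swap_bases; case: ifP.
- by have := energy_swap_bases iIJ jJI; rewrite /= -/IJ => ?; lra.
- by rewrite subUset sub1set iI0.
- by rewrite subUset sub1set jJ0.
- rewrite dI; apply/subsetP=> v /setD1P[vi /(subsetP IX)].
  by rewrite !inE negb_or vi.
- rewrite dJ; apply/subsetP=> v /setD1P[vj /(subsetP JY)].
  by rewrite !inE negb_or vj.
(* The bases now agree at [i] and [j], and they still agree on the old group since the differences
   have only shrunk. *)
- move=> v /U'P vU.
  have vN : v \notin IJ.1 :\: IJ.2 /\ v \notin IJ.2 :\: IJ.1.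
    rewrite dI dJ; case/or3P: vU => [/eqP->|/eqP->|vU].
    + by case/setDP: iIJ => iI iJ; rewrite !inE eqxx (negPf iJ) !andbF.
    + by case/setDP: jJI => jJ jI; rewrite !inE eqxx (negPf jI) !andbF.
    + by have := UP v vU; rewrite !inE => ->; case: (v \in J); rewrite ?andbF.
  by case: vN; rewrite !inE; case: (v \in IJ.1); case: (v \in IJ.2).
- rewrite !big_setU1 //=; have := pairK j iI0.
  by rewrite !mulrBr !mulrDr in Ka * => ?; lra.
Qed.

Lemma swap_inv_base I J U V : swap_inv I J U V -> base M I /\ base M J.
Proof. by case. Qed.

Lemma swap_inv_indep I J U V : swap_inv I J U V -> indep M U.
Proof. by case. Qed.

Lemma swap_inv_le I J U V V' : V <= V' -> swap_inv I J U V -> swap_inv I J U V'.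
Proof.
move=> le [a au m X Y bI bJ He XI YJ IX JY UP Ka iU fau fV aV mU].
apply: (@SwapInv _ _ _ _ a au m X Y) => //; first exact: le_trans fV le.
by apply: le_trans aV _; rewrite ler_wpM2l.
Qed.

Lemma swap_inv_final I J U V : swap_inv I J U V -> I \subset J ->
  f I0 <= V -> f J0 <= V -> f I <= V ->
  bil 1_I0 1_J0 <= 4 * V + 7 * K * V /\
  bil 1_I0 1_J0 <= 5 * V + 2 * ((rank M)%:R / (c%:R - 2)) * V.
Proof.
move=> [a au m X Y bI bJ He XI YJ IX JY UP Ka iU fau fV aV mU] sIJ fI0 fJ0 fI.
have IJ : I = J.
  by apply/eqP; rewrite eqEcard sIJ (card_base bI) (card_base bJ) leqnn.
have pos S T : 0 <= bil 1_S 1_T by apply: bil_ge0 => //; apply: charvec_nonneg.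
have lpos S : 0 <= lin 1_S by apply: lin_ge0 => //; apply: charvec_nonneg.
have V0 : 0 <= V by apply: le_trans fI; apply: quad_setfun_ge0.
(* The initial energy contains [bil 1_I0 1_J0] twice, and the final one is [8 * f I]. *)
have D : bil 1_I0 1_J0 <= 4 * V + a.
  move: He; rewrite -IJ energy_charvec /energy !(bilDl, bilDr, linD).
  rewrite (bilC symA 1_J0 1_I0).
  have := pos I0 I0; have := pos J0 J0; have := lpos I0; have := lpos J0.
  by lra.
have g0 i : 0 <= g i.
  by rewrite addr_ge0 // bil_ge0 //; [apply: delta_nonneg|apply: charvec_nonneg].
have sum_g S (T : {set _}) : S \subset T -> \sum_(i in S) g i <= bil 1_T 1_I0 + lin 1_T.
  move=> sST; have -> : bil 1_T 1_I0 + lin 1_T = \sum_(i in T) g i.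
    rewrite bilE linE -big_split /= [RHS]big_mkcond; apply: eq_bigr => i _ /=.
    rewrite !mxE /g bil_deltal.
    by case: (i \in T); rewrite ?mul1r ?mulr1 ?mul0r ?mulr0 ?addr0.
  rewrite [leLHS]big_mkcond [leRHS]big_mkcond; apply: ler_sum => i _.
  by case: ifP => [/(subsetP sST)->//|_]; case: ifP.
split.
  (* The sum over [X] is at most [2 * V]; the sum over [Y] is at most [bil 1_J0 1_I0 + V], hence at
     most [5 * V + a] by [D]. The term [- a] in the invariant cancels this [a], leaving [7 * V]. *)
  suff : a <= K * (7 * V) by lra.
  apply: le_trans Ka _; apply: ler_wpM2l => //.
  have := sum_g _ _ XI; have := sum_g _ _ YJ.
  rewrite !quad_setfunE in fI0 fJ0; rewrite (bilC symA 1_J0 1_I0).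
  have := pos I0 I0; have := pos J0 J0; have := lpos I0; have := lpos J0.
  by lra.
have c2 : 0 < c%:R - 2 :> R by rewrite subr_gt0 ltr_nat.
(* The closed groups use at least [m * (c - 2)] of the at most [2 * rank M] exchanged elements; the
   current group adds one more [V]. *)
have mr : m%:R <= 2 * ((rank M)%:R / (c%:R - 2)) :> R.
  rewrite mulrA ler_pdivlMr // -[2]/(2%:R) -natrB ?(ltnW c_gt2) // -!natrM ler_nat.
  apply: leq_trans (leq_addr _ _) (leq_trans mU _).
  by rewrite leq_mul2l -(card_base bI0) subset_leq_card.
have := ler_wpM2r V0 mr; lra.
Qed.

End SwapRounding.

(** * Programs with bounded loops *)

(* Programs whose only loops are [For i P], which runs [P] with register [i] set
   successively to [0, ..., n - 1]; such programs always halt, so that they have a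
   functional semantics. Register [1] is reserved for the size [n]. *)
Inductive routine :=
| Do (c : instr)
| Skip
| Then (P Q : routine)
| Cond (t : test) (P Q : routine)
| For (i : nat) (P : routine).

Declare Scope routine_scope.
Delimit Scope routine_scope with routine.
Bind Scope routine_scope with routine.
Coercion Do : instr >-> routine.
Notation "P ;; Q" := (Then P Q) (at level 100, right associativity) : routine_scope.

(** As [prog] has no empty program, [Skip] becomes a loop whose test, a register being less than
    itself, fails at once. *)
Fixpoint compile (P : routine) : prog :=
  match P with
  | Do c => Instr c
  | Skip => While (RegLt 0 0) (Instr (RegZero 0))
  | Then P Q => Seq (compile P) (compile Q)
  | Cond t P Q => If t (compile P) (compile Q)
  | For i P => Seq (Instr (RegZero i))
      (While (RegLt i 1) (Seq (compile P) (Instr (RegSucc i))))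
  end.

(** A polynomial in [n]: a conditional is charged for both branches, and an iteration for its body,
    a test and an increment. *)
Fixpoint cost (P : routine) : {poly nat} :=
  match P with
  | Do _ | Skip => 1
  | Then P Q => cost P + cost Q
  | Cond _ P Q => 1 + (cost P + cost Q)
  | For _ P => 1 + ('X * (cost P + 2%:P) + 1)
  end.

(** What an instruction may write. Arrays are tracked as a whole, since indices live in registers;
    frame conditions then follow by computation. *)
Definition instr_regs (c : instr) : seq nat :=
  match c with
  | RegZero i | RegSize i | RegSucc i | RegCopy i _ => [:: i]
  | _ => [::]
  end.

Definition instr_bits (c : instr) : seq nat :=
  if c is BitSet a _ then [:: a.1] else [::].

Definition instr_reals (c : instr) : seq nat :=
  match c with
  | RealZero p | RealOne p | RealCopy p _ | RealAdd p _ | RealSub p _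
  | RealMulA p _ _ | RealMulB p _ | RealMulX p _ => [:: p.1]
  | _ => [::]
  end.

Section Modified.
Variable instr_mod : instr -> seq nat.
Fixpoint mods (P : routine) : seq nat :=
  match P with
  | Do c => instr_mod c
  | Skip => [::]
  | Then P Q | Cond _ P Q => mods P ++ mods Q
  | For i P => instr_mod (RegZero i) ++ mods P
  end.
End Modified.

Notation regs := (mods instr_regs).
Notation bits := (mods instr_bits).
Notation reals := (mods instr_reals).

Fixpoint loops_ok (P : routine) : bool :=
  match P with
  | Do _ | Skip => true
  | Then P Q | Cond _ P Q => loops_ok P && loops_ok Q
  | For i P => (i \notin regs P) && loops_ok P
  end.

Section Eval.
Variables (R : realType) (n : nat).
Variables (A : 'M[R]_n) (b x : 'cV[R]_n) (oracle : pred {set 'I_n}).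
Implicit Types (s : state R) (P Q : routine).

Local Notation exec := (eval_instr A b x).
Local Notation holds := (eval_test oracle).

Fixpoint sem P s : state R :=
  match P with
  | Do c => exec s c
  | Skip => s
  | Then P Q => sem Q (sem P s)
  | Cond t P Q => if holds s t then sem P s else sem Q s
  | For i P => iter n (fun s => exec (sem P s) (RegSucc i)) (exec s (RegZero i))
  end.

Lemma sem_reg P s i : i \notin regs P -> reg (sem P s) i = reg s i.
Proof.
have updN s' j k : i \notin [:: j] -> reg (set_reg s' j k) i = reg s' i.
  by rewrite inE /= /upd => /negPf->.
elim: P s => [c|//|P IHP Q IHQ|t P IHP Q IHQ|j P IHP] s /=.
- by case: c => //= *; apply: updN.
- by rewrite mem_cat negb_or => /andP[iP iQ]; rewrite IHQ // IHP.
- by rewrite mem_cat negb_or => /andP[iP iQ]; case: ifP => _; [apply: IHP|apply: IHQ].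
- rewrite inE negb_or => /andP[ij iP].
  set st := fun s => _; have H m : reg (iter m st (set_reg s j 0)) i = reg s i.
    by elim: m => [|m IHm] /=; rewrite /upd (negPf ij) // IHP.
  exact: H.
Qed.

Lemma sem_bit P s a k : a \notin bits P -> bit (sem P s) (a, k) = bit s (a, k).
Proof.
elim: P s => [c|//|P IHP Q IHQ|t P IHP Q IHQ|j P IHP] s /=.
- by case: c => //= p v; rewrite inE /upd xpair_eqE => /negPf->.
- by rewrite mem_cat negb_or => /andP[iP iQ]; rewrite IHQ // IHP.
- by rewrite mem_cat negb_or => /andP[iP iQ]; case: ifP => _; [apply: IHP|apply: IHQ].
- move=> aP; set st := fun s => _; set s0 := set_reg _ _ _.
  have H m : bit (iter m st s0) (a, k) = bit s (a, k).
    by elim: m => [|m IHm] //=; rewrite IHP.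
  exact: H.
Qed.

Lemma sem_real P s a k : a \notin reals P -> real (sem P s) (a, k) = real s (a, k).
Proof.
have updN s' p y : a \notin [:: p.1] -> real (set_real s' p y) (a, k) = real s' (a, k).
  by rewrite inE /= /upd xpair_eqE => /negPf->.
elim: P s => [c|//|P IHP Q IHQ|t P IHP Q IHQ|j P IHP] s /=.
- by case: c => //= *; apply: updN.
- by rewrite mem_cat negb_or => /andP[iP iQ]; rewrite IHQ // IHP.
- by rewrite mem_cat negb_or => /andP[iP iQ]; case: ifP => _; [apply: IHP|apply: IHQ].
- move=> aP; set st := fun s => _; set s0 := set_reg _ _ _.
  have H m : real (iter m st s0) (a, k) = real s (a, k).
    by elim: m => [|m IHm] //=; rewrite IHP.
  exact: H.
Qed.

Definition unmodified P s s' := [/\ forall i, i \notin regs P -> reg s' i = reg s i,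
  forall a k, a \notin bits P -> bit s' (a, k) = bit s (a, k)
  & forall a k, a \notin reals P -> real s' (a, k) = real s (a, k)].

(** The loop rule supplies the frame condition and the counter value at each iteration, so an
    invariant only needs to describe what the body changes. *)
Lemma for_ind i P (Inv : nat -> state R -> Prop) s : i \notin regs P ->
  Inv 0%N (set_reg s i 0) ->
  (forall k s', (k < n)%N -> unmodified (For i P) s s' -> reg s' i = k ->
    Inv k s' -> Inv k.+1 (set_reg (sem P s') i k.+1)) ->
  Inv n (sem (For i P) s).
Proof.
move=> iP Inv0 InvS /=; set st := fun s => _; set s0 := set_reg s i 0.
suff H k : (k <= n)%N -> [/\ unmodified (For i P) s (iter k st s0),
    reg (iter k st s0) i = k & Inv k (iter k st s0)].
  by case: (H n (leqnn n)).
elim: k => [|k IHk] kn.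
  split=> //; last by rewrite /= /upd eqxx.
  by split=> // j; rewrite /= inE negb_or /upd => /andP[/negPf-> _].
have [[Ur Ub Ux] ki Ik] := IHk (ltnW kn).
have stE : iter k.+1 st s0 = set_reg (sem P (iter k st s0)) i k.+1.
  by rewrite iterS /st /eval_instr sem_reg // ki.
rewrite stE; split; last exact: InvS; last by rewrite /= /upd eqxx.
split=> [j|a l|a l] H.
- rewrite -Ur //; move: H; rewrite /= inE negb_or /upd => /andP[/negPf-> jP].
  exact: sem_reg.
- by rewrite -Ub // sem_bit.
- by rewrite -Ux // sem_real.
Qed.

Lemma compile_run P s : loops_ok P -> 1%N \notin regs P -> reg s 1 = n ->
  exists2 t, run A b x oracle (compile P) s (sem P s) t & (t <= (cost P).[n])%N.
Proof.
elim: P s => [c||P IHP Q IHQ|t P IHP Q IHQ|i P IHP] s /=.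
- by move=> _ _ _; exists 1%N; [apply: RunInstr|rewrite hornerC].
- move=> _ _ _; exists 1%N; last by rewrite hornerC.
  by apply: RunWhileF; rewrite /= ltnn.
- rewrite mem_cat negb_or => /andP[lP lQ] /andP[rP rQ] s1.
  have [t1 run1 t1P] := IHP s lP rP s1.
  have [|t2 run2 t2P] := IHQ (sem P s) lQ rQ; first by rewrite sem_reg.
  by exists (t1 + t2)%N; [apply: RunSeq run1 run2|rewrite hornerD leq_add].
- rewrite mem_cat negb_or => /andP[lP lQ] /andP[rP rQ] s1.
  have [t1 run1 t1P] := IHP s lP rP s1.
  have [t2 run2 t2P] := IHQ s lQ rQ s1.
  rewrite !hornerD hornerC; case: ifP => E.
    exists t1.+1; first by apply: RunIf; rewrite E.
    by rewrite -[t1.+1]add1n leq_add2l (leq_trans t1P) ?leq_addr.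
  exists t2.+1; first by apply: RunIf; rewrite E.
  by rewrite -[t2.+1]add1n leq_add2l (leq_trans t2P) ?leq_addl.
- rewrite inE negb_or => /andP[iP lP] /andP[i1 rP] s1.
  set st := fun s => _; set s0 := set_reg s i 0.
  have H k : reg (iter k st s0) i = k /\ reg (iter k st s0) 1 = n.
    elim: k => [|k [IH1 IH2]]; first by rewrite /= /upd eqxx (negPf i1).
    by rewrite /= /upd eqxx (negPf i1) !sem_reg // IH1.
  (* Induction on the number [d] of remaining iterations: [run] unfolds a loop from its first
     iteration, [iter] from its last. *)
  have W d k : (k + d = n)%N -> exists2 t,
      run A b x oracle (While (RegLt i 1) (Seq (compile P) (Instr (RegSucc i))))
        (iter k st s0) (iter n st s0) t & (t <= d * ((cost P).[n] + 2) + 1)%N.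
    elim: d k => [|d IHd] k kd.
      rewrite addn0 in kd; exists 1%N => //; rewrite kd.
      by apply: RunWhileF; rewrite /=; have [-> ->] := H n; rewrite ltnn.
    have [|t2 run2 t2P] := IHd k.+1; first by rewrite addSnnS.
    have [Hk1 Hk2] := H k; have [t1 run1 t1P] := IHP _ lP rP Hk2.
    exists (t1 + 1 + t2).+1.
      apply: RunWhileT run2; first by rewrite /= Hk1 Hk2 -kd addnS ltnS leq_addr.
      exact: RunSeq run1 (RunInstr _ _ _ _ _ _).
    rewrite mulSn -[(t1 + 1 + t2).+1]addSn -addnA leq_add //.
    by rewrite addn1 addn2 !ltnS.
  have [t run_t tP] := W n 0%N (add0n n).
  exists (1 + t)%N.
    by apply: (RunSeq _ run_t); apply: (RunInstr _ _ _ _ (RegZero i)).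
  by rewrite !hornerD hornerM hornerD !hornerC hornerX leq_add2l.
Qed.

Definition vec s a : 'cV[R]_n := \col_i real s (a, nat_of_ord i).

Lemma sem_bitset P s a : a \notin bits P -> bitset n (sem P s) a = bitset n s a.
Proof. by move=> aP; apply/setP=> v; rewrite !inE sem_bit. Qed.

Lemma bitset_setT s a i (k : 'I_n) : reg s i = k ->
  bitset n (set_bit s (a, i) true) a = k |: bitset n s a.
Proof.
move=> ik; apply/setP=> v; rewrite !inE /= /upd /addr /= ik xpair_eqE eqxx /=.
by rewrite -(inj_eq val_inj) /=; case: eqP.
Qed.

Lemma bitset_setF s a i (k : 'I_n) : reg s i = k ->
  bitset n (set_bit s (a, i) false) a = bitset n s a :\ k.
Proof.
move=> ik; apply/setP=> v; rewrite !inE /= /upd /addr /= ik xpair_eqE eqxx /=.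
by rewrite -(inj_eq val_inj) /=; case: eqP.
Qed.

Lemma bitset_neq s a a' i v : a' != a ->
  bitset n (set_bit s (a, i) v) a' = bitset n s a'.
Proof.
by move=> /negPf aa'; apply/setP=> u; rewrite !inE /= /upd xpair_eqE aa'.
Qed.

Lemma entry1_ord (y : 'cV[R]_n) (i : 'I_n) : entry1 y i = y i 0.
Proof. by rewrite /entry1 valK. Qed.

Lemma entry2_ord (B : 'M[R]_n) (i j : 'I_n) : entry2 B i j = B i j.
Proof. by rewrite /entry2 !valK. Qed.

End Eval.

(** * The rounding program *)

(* Real arrays: [0] holds a vector [y] and [1] the weights [A y + 2 b]; the scalars,
   stored at index [0] of their array, are a temporary [2], an accumulator [3] and
   the value [2 f(S)] of the best set found so far [4].
   Bit arrays: [0] is the best set, [1] and [2] are the two bases, [3] is the current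
   group of swapped pairs and [4] the set of elements processed by the greedy
   algorithm. *)
Section Routines.
Local Open Scope nat_scope.

(** Nested loops need distinct counters, hence a fixed allocation: register 0 stays 0, 2 and 3 hold
    the pair to exchange, 4 counts greedy rounds, 5 and 6 serve the search for a heaviest element, 7
    and 8 index [A], and 9 is for simple scans. *)
Definition clear_vec : routine := For 9 (RealZero (0, 9)).

Definition load_x : routine := For 9 (RealOne (0, 9);; RealMulX (0, 9) 9).

Definition add_bits a : routine :=
  For 9 (Cond (BitOn (a, 9)) (RealOne (2, 0);; RealAdd (0, 9) (2, 0)) Skip).

Definition add_row : routine :=
  For 8 (RealCopy (2, 0) (0, 8);; RealMulA (2, 0) 7 8;; RealAdd (1, 7) (2, 0)).

Definition weights : routine :=
  For 7 (RealZero (1, 7);; RealOne (2, 0);; RealMulB (2, 0) 7;;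
         RealAdd (1, 7) (2, 0);; RealAdd (1, 7) (2, 0);; add_row).

Definition sum_weights a : routine :=
  (RealZero (3, 0);; For 9 (Cond (BitOn (a, 9)) (RealAdd (3, 0) (1, 9)) Skip)).

Definition copy_best a : routine :=
  For 9 (Cond (BitOn (a, 9)) (BitSet (0, 9) true) (BitSet (0, 9) false)).

Definition clear_bits a : routine := For 9 (BitSet (a, 9) false).

Definition value a : routine :=
  (clear_vec;; add_bits a;; weights;; sum_weights a).

Definition record a : routine :=
  (value a;; Cond (RealLe (3, 0) (4, 0)) Skip (RealCopy (4, 0) (3, 0);; copy_best a)).

(** Index [n], outside the ground set, is a sentinel of weight 0; as the weights are nonnegative,
    the first unprocessed element replaces it. *)
Definition pick_max : routine :=
  (RegSize 6;; RealZero (1, 6);;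
   For 5 (Cond (BitOn (4, 5)) Skip (Cond (RealLe (1, 6) (1, 5)) (RegCopy 6 5) Skip))).

Definition greedy_round a : routine :=
  (pick_max;; BitSet (4, 6) true;; BitSet (a, 6) true;;
   Cond (Indep a) Skip (BitSet (a, 6) false)).

Definition greedy a : routine :=
  (weights;; clear_bits a;; clear_bits 4;; For 4 (greedy_round a)).

Definition restore1 : routine := (BitSet (1, 2) true;; BitSet (1, 3) false).
Definition restore2 : routine := (BitSet (2, 3) true;; BitSet (2, 2) false).

Definition extend : routine :=
  (BitSet (3, 3) true;; BitSet (3, 2) true;;
   Cond (Indep 3) Skip (clear_bits 3;; BitSet (3, 3) true;; BitSet (3, 2) true)).

(** This runs after the exchange has been made in both bases, which leaves the sum of their
    characteristic vectors unchanged. The weights are thus still those of the original pair, and one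
    of the two exchanges is then undone. *)
Definition choose_side : routine :=
  (clear_vec;; add_bits 1;; add_bits 2;; weights;;
   Cond (RealLe (1, 2) (1, 3)) restore2 restore1).

Definition exchange : routine :=
  (BitSet (1, 2) false;; BitSet (1, 3) true;; BitSet (2, 3) false;; BitSet (2, 2) true;;
   Cond (Indep 1)
     (Cond (Indep 2) (choose_side;; extend;; record 3) (restore1;; restore2))
     (restore1;; restore2)).

Definition try_exchange : routine :=
  Cond (BitOn (1, 2))
    (Cond (BitOn (2, 2)) Skip
      (Cond (BitOn (2, 3)) (Cond (BitOn (1, 3)) Skip exchange) Skip)) Skip.

(** One pass suffices: symmetric exchange provides a partner for every [i] still in the difference,
    and the difference never grows. *)
Definition swap_rounding : routine := For 2 (For 3 try_exchange).

Definition rounding : routine :=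
  (load_x;; greedy 2;; clear_vec;; add_bits 2;; greedy 1;;
   record 1;; record 2;; swap_rounding;; record 1).

End Routines.

(** * Correctness of the vector, weight and search routines *)

Section Correctness.
Variables (R : realType) (n : nat).
Variables (A : 'M[R]_n) (b x : 'cV[R]_n) (M : matroid n).
Implicit Types (s : state R) (P Q : routine) (v : 'I_n).
Local Notation sem := (sem A b x (indep M)).
Local Notation f := (quad_setfun A b).
Local Notation vec := (vec n).
Local Notation bitset := (bitset n).

Lemma ltnS_neq (k l : nat) : (k < l.+1)%N -> k != l -> (k < l)%N.
Proof. by rewrite ltnS leq_eqVlt => /orP[->|]. Qed.

Lemma clear_vecP s : vec (sem clear_vec s) 0 = 0.
Proof.
(* The bound [v < n] is added so that the goal is the loop invariant at [n]; the same device recurs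
   below. *)
suff H : forall v, (v < n)%N -> real (sem clear_vec s) (0%N, nat_of_ord v) = 0.
  by apply/colP=> v; rewrite !mxE H.
apply: (for_ind (Inv := fun k s' =>
  forall v, (v < k)%N -> real s' (0%N, nat_of_ord v) = 0)) => //.
move=> k s' kn _ rk Ik v vk; rewrite /= /upd xpair_eqE /= rk.
by case: eqP => // /eqP vNk; apply: Ik; apply: ltnS_neq.
Qed.

Lemma load_xP s : vec (sem load_x s) 0 = x.
Proof.
suff H : forall v, (v < n)%N -> real (sem load_x s) (0%N, nat_of_ord v) = x v 0.
  by apply/colP=> v; rewrite !mxE H.
apply: (for_ind (Inv := fun k s' =>
  forall v, (v < k)%N -> real s' (0%N, nat_of_ord v) = x v 0)) => //.
move=> k s' kn _ rk Ik v vk; rewrite /= /upd !xpair_eqE /= rk eqxx mul1r.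
case: eqP => [<-|/eqP vNk]; first by rewrite entry1_ord.
by apply: Ik; apply: ltnS_neq.
Qed.

Lemma add_bitsP s a : vec (sem (add_bits a) s) 0 = vec s 0 + charvec R (bitset s a).
Proof.
suff H : forall v, real (sem (add_bits a) s) (0%N, nat_of_ord v) =
    real s (0%N, nat_of_ord v) + ((v < n)%N && bit s (a, nat_of_ord v))%:R.
  by apply/colP=> v; rewrite !mxE H inE ltn_ord.
apply: (for_ind (Inv := fun k s' => forall v, real s' (0%N, nat_of_ord v) =
    real s (0%N, nat_of_ord v) + ((v < k)%N && bit s (a, nat_of_ord v))%:R)) => //.
  by move=> v; rewrite ltn0 addr0.
move=> k s' kn [_ Ub _] rk Ik v; rewrite /= /addr /= rk Ub //.
case: ifP => bk; rewrite /= /upd ?xpair_eqE /= ?rk ?xpair_eqE /=; last first.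
  rewrite Ik [in RHS]ltnS [in RHS]leq_eqVlt; case: eqP => [->|//].
  by rewrite ltnn bk.
rewrite !eqxx /= [in RHS]ltnS [in RHS]leq_eqVlt; case: eqP => [vk|_]; last by rewrite Ik.
by rewrite /= -vk Ik vk ltnn addr0 bk.
Qed.


Lemma add_rowP s (i : 'I_n) : reg s 7 = i ->
  real (sem add_row s) (1%N, nat_of_ord i) =
    real s (1%N, nat_of_ord i) + \sum_j A i j * vec s 0 j 0 /\
  forall k, k != i :> nat -> real (sem add_row s) (1%N, k) = real s (1%N, k).
Proof.
move=> ri.
suff : [/\ real (sem add_row s) (1%N, nat_of_ord i) =
     real s (1%N, nat_of_ord i) + \sum_(j < n | (j < n)%N) A i j * vec s 0 j 0 &
     forall k, k != i :> nat -> real (sem add_row s) (1%N, k) = real s (1%N, k)].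
  case=> -> H; split=> //.
  by congr (_ + _); apply: eq_bigl => j; rewrite ltn_ord.
apply: (for_ind (Inv := fun k s' => [/\ real s' (1%N, nat_of_ord i) =
     real s (1%N, nat_of_ord i) + \sum_(j < n | (j < k)%N) A i j * vec s 0 j 0 &
     forall k, k != i :> nat -> real s' (1%N, k) = real s (1%N, k)])) => //.
  by split=> //; rewrite big_pred0 ?addr0.
move=> k s' kn [Ur _ Ux] rk [Ik Il]; split; last first.
  move=> l li; rewrite /= /upd !xpair_eqE /= (Ur 7%N) // ri (negPf li) /= Il //.
rewrite /= /upd !xpair_eqE /= /addr /= (Ur 7%N) // ri rk !eqxx /= Ik -addrA.
congr (_ + _); pose j := Ordinal kn.
rewrite [RHS](bigD1 j) //= addrC; congr (_ + _).
  by rewrite -[k]/(nat_of_ord j) entry2_ord Ux // mxE mulrC.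
apply: eq_bigl => l; rewrite ltnS [in RHS]leq_eqVlt -(inj_eq val_inj) /=.
by case: eqP => [->|] //=; rewrite ?ltnn ?andbT // andbF.
Qed.

Lemma weightsP s v : real (sem weights s) (1%N, nat_of_ord v) = weight A b (vec s 0) v.
Proof.
suff : forall v, (v < n)%N ->
    real (sem weights s) (1%N, nat_of_ord v) = weight A b (vec s 0) v by apply.
apply: (for_ind (Inv := fun k s' => forall v, (v < k)%N ->
    real s' (1%N, nat_of_ord v) = weight A b (vec s 0) v)) => //.
move=> k s' kn [Ur _ Ux] rk Ik {}v vk.
pose i := Ordinal kn; rewrite -[k]/(nat_of_ord i) in rk Ik *.
set body := Then _ _; set s1 := sem (RealZero (1, 7)%N;; RealOne (2, 0)%N;;
  RealMulB (2, 0)%N 7;; RealAdd (1, 7)%N (2, 0)%N;; RealAdd (1, 7)%N (2, 0)%N)%routine s'.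
have -> : sem body s' = sem add_row s1 by [].
have rs1 : reg s1 7 = i by [].
have vs1 : vec s1 0 = vec s 0 by apply/colP=> j; rewrite !mxE -Ux.
have [E1 E2] := add_rowP rs1; rewrite vs1 in E1.
change (real (sem add_row s1) (1%N, nat_of_ord v) = weight A b (vec s 0) v).
have [vi|vNi] := eqVneq (nat_of_ord v) i.
  have -> : v = i by apply: val_inj.
  rewrite E1 /weight addrC; congr (_ + _).
  rewrite /= /upd !xpair_eqE /= /addr /= ?xpair_eqE /= rk !eqxx /=.
  by rewrite -[k]/(nat_of_ord i) entry1_ord add0r mul1r mulr_natl mulr2n.
rewrite (E2 _ vNi); transitivity (real s' (1%N, nat_of_ord v)); last first.
  by apply: Ik; apply: ltnS_neq.
rewrite /= /upd !xpair_eqE /= /addr /= ?xpair_eqE /= rk.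
by rewrite (negPf vNi).
Qed.

Lemma sum_weightsP s a :
  real (sem (sum_weights a) s) (3%N, reg s 0) = \sum_(v in bitset s a) vec s 1 v 0.
Proof.
set s0 := sem (RealZero (3, 0)%N) s.
have -> : sem (sum_weights a) s = sem (For 9 (Cond (BitOn (a, 9)%N)
  (RealAdd (3, 0)%N (1, 9)%N) Skip)) s0 by [].
suff -> : real (sem (For 9 (Cond (BitOn (a, 9)%N) (RealAdd (3, 0)%N (1, 9)%N) Skip)) s0)
    (3%N, reg s 0) = \sum_(v < n | (v < n)%N && (v \in bitset s a)) vec s 1 v 0.
  by apply: eq_bigl => v; rewrite ltn_ord.
apply: (for_ind (Inv := fun k s' => real s' (3%N, reg s 0) =
   \sum_(v < n | (v < k)%N && (v \in bitset s a)) vec s 1 v 0)) => //.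
  by rewrite big_pred0 // /= /upd xpair_eqE !eqxx.
move=> k s' kn [Ur Ub Ux] rk Ik; pose i := Ordinal kn.
rewrite /= /addr /= rk Ub //; case: ifP => bk.
  rewrite /= /upd !xpair_eqE /= (Ur 0%N) // !eqxx /= Ik /addr /= ?rk Ux //.
  rewrite [RHS](bigD1 i) /= ?ltnSn ?inE //= addrC mxE; congr (_ + _).
  apply: eq_bigl => l; rewrite [in RHS]ltnS [in RHS]leq_eqVlt -(inj_eq val_inj) /=.
  by case: eqP => [->|] //=; rewrite ?ltnn ?andbT // andbF.
rewrite /= Ik; apply: eq_bigl => l; rewrite [in RHS]ltnS [in RHS]leq_eqVlt.
by case: eqP => [lk|] //=; rewrite lk ltnn inE lk [RHS]bk.
Qed.

Lemma valueP s a : real (sem (value a) s) (3%N, reg s 0) = 2 * f (bitset s a).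
Proof.
set s1 := sem (add_bits a) (sem clear_vec s); set s2 := sem weights s1.
have r2 : reg s2 0 = reg s 0 by rewrite !sem_reg.
have b2 : bitset s2 a = bitset s a by rewrite !sem_bitset.
have v1 : vec s1 0 = charvec R (bitset s a).
  by rewrite add_bitsP clear_vecP add0r sem_bitset.
rewrite -[sem (value a) s]/(sem (sum_weights a) s2) -r2 sum_weightsP b2.
rewrite -sum_weight_self; apply: eq_bigr => v _.
by rewrite mxE weightsP v1.
Qed.

Lemma copy_bestP s a : a != 0%N -> bitset (sem (copy_best a) s) 0 = bitset s a.
Proof.
move=> a0; suff H : forall v, (v < n)%N ->
    bit (sem (copy_best a) s) (0%N, nat_of_ord v) = bit s (a, nat_of_ord v).
  by apply/setP=> v; rewrite !inE H.
apply: (for_ind (Inv := fun k s' => forall v, (v < k)%N ->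
  bit s' (0%N, nat_of_ord v) = bit s (a, nat_of_ord v))) => //.
move=> k s' kn [_ Ub _] rk Ik v vk; rewrite /= /addr /= rk Ub; last first.
  by rewrite /= !inE negb_or a0.
case: ifP => bk; rewrite /= /upd xpair_eqE /= rk.
  by case: eqP => [->|/eqP vNk]; rewrite ?bk // Ik // ltnS_neq.
by case: eqP => [->|/eqP vNk]; rewrite ?bk // Ik // ltnS_neq.
Qed.

Lemma clear_bitsP s a : bitset (sem (clear_bits a) s) a = set0.
Proof.
suff H : forall v, (v < n)%N -> bit (sem (clear_bits a) s) (a, nat_of_ord v) = false.
  by apply/setP=> v; rewrite !inE H.
apply: (for_ind (Inv := fun k s' => forall v, (v < k)%N ->
  bit s' (a, nat_of_ord v) = false)) => //.
move=> k s' kn _ rk Ik v vk; rewrite /= /upd xpair_eqE eqxx /= rk.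
by case: eqP => // /eqP vNk; apply: Ik; apply: ltnS_neq.
Qed.

Definition best_ok s :=
  real s (4%N, reg s 0) = 2 * f (bitset s 0) /\ indep M (bitset s 0).

Lemma recordP s a : a != 0%N -> best_ok s -> indep M (bitset s a) ->
  let s' := sem (record a) s in
  [/\ best_ok s', f (bitset s 0) <= f (bitset s' 0) & f (bitset s a) <= f (bitset s' 0)].
Proof.
move=> a0 [Hr Hi] Ha; cbv zeta; set s1 := sem (value a) s.
have r1 : reg s1 0 = reg s 0 by rewrite sem_reg.
have b1 c : bitset s1 c = bitset s c by rewrite sem_bitset.
have x1 : real s1 (4%N, reg s1 0) = 2 * f (bitset s 0) by rewrite r1 sem_real.
have y1 : real s1 (3%N, reg s1 0) = 2 * f (bitset s a) by rewrite r1 valueP.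
have -> : sem (record a) s = if real s1 (3%N, reg s1 0) <= real s1 (4%N, reg s1 0)
  then s1 else sem (copy_best a) (sem (RealCopy (4, 0)%N (3, 0)%N) s1) by [].
rewrite x1 y1; case: ifP => [le|/negbT]; last rewrite -ltNge => lt.
  by rewrite /best_ok x1 !b1; split=> //; lra.
rewrite /best_ok copy_bestP //.
set s2 := sem (RealCopy _ _) s1.
have b2 : bitset s2 a = bitset s a by rewrite -b1.
rewrite sem_reg // sem_real // b2; split; [split=> //| |] => //.
  by rewrite -y1 /s2 /= /upd eqxx.
by lra.
Qed.

(** The sentinel is written into the weight array itself, so [sem_real] does not apply there and the
    preservation of the weights is part of the invariant. *)
Lemma pick_maxP s : (forall v, 0 <= real s (1%N, nat_of_ord v)) ->
  (exists v, v \notin bitset s 4) ->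
  (exists m : 'I_n, [/\ reg (sem pick_max s) 6 = m, m \notin bitset s 4 &
    forall u, u \notin bitset s 4 ->
      real s (1%N, nat_of_ord u) <= real s (1%N, nat_of_ord m)]) /\
  forall v, real (sem pick_max s) (1%N, nat_of_ord v) = real s (1%N, nat_of_ord v).
Proof.
move=> w0 [v0 v0P]; set s1 := sem (RegSize 6;; RealZero (1, 6)%N)%routine s.
pose P := For 5 (Cond (BitOn (4, 5)%N) Skip
  (Cond (RealLe (1, 6)%N (1, 5)%N) (RegCopy 6 5) Skip)).
rewrite -[sem pick_max s]/(sem P s1).
have [H1 H2] : ((reg (sem P s1) 6 = n /\ forall u : 'I_n, (u < n)%N -> u \in bitset s 4) \/
  exists m : 'I_n, [/\ reg (sem P s1) 6 = m, m \notin bitset s 4 &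
    forall u : 'I_n, (u < n)%N -> u \notin bitset s 4 ->
      real s (1%N, nat_of_ord u) <= real s (1%N, nat_of_ord m)]) /\
  ((forall v, real (sem P s1) (1%N, nat_of_ord v) = real s (1%N, nat_of_ord v))
   /\ real (sem P s1) (1%N, n) = 0); last first.
  split; last by case: H2.
  case: H1 => [[_ /(_ v0 (ltn_ord v0))]|[m [H H' H'']]]; first by rewrite (negPf v0P).
  by exists m; split=> // u; apply: H''.
apply: (for_ind (Inv := fun k s' =>
  ((reg s' 6 = n /\ forall u : 'I_n, (u < k)%N -> u \in bitset s 4) \/
  exists m : 'I_n, [/\ reg s' 6 = m, m \notin bitset s 4 &
    forall u : 'I_n, (u < k)%N -> u \notin bitset s 4 ->
      real s (1%N, nat_of_ord u) <= real s (1%N, nat_of_ord m)]) /\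
  ((forall v, real s' (1%N, nat_of_ord v) = real s (1%N, nat_of_ord v))
   /\ real s' (1%N, n) = 0))) => //.
  split; first by left.
  split; last by rewrite /= /upd /addr /= !eqxx.
  move=> v; rewrite /= /upd /addr /= xpair_eqE eqxx /= ltn_eqF //.
move=> k s' kn [_ Ub _] rk [Ik [Iw In]]; pose i := Ordinal kn.
have lek (u : 'I_n) : (u < k.+1)%N -> u != i -> (u < k)%N.
  by move=> uk ui; apply: ltnS_neq.
rewrite /= /addr /= rk Ub //.
rewrite -[bit _ (4%N, k)](in_set (fun v : 'I_n => bit s (4%N, nat_of_ord v)) i).
rewrite -/(bitset s 4); case: ifP => iP.
  split=> //=; case: Ik => [[Ek Hk]|[m [Em mP Hm]]]; [left|right].
    by split=> // u uk; have [->//|ui] := eqVneq u i; apply: Hk; apply: lek.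
  exists m; split=> // u uk uP; apply: Hm => //; apply: lek => //.
  by apply: contraNneq uP => ->.
have Ii := Iw i; rewrite /= in Ii; rewrite Ii.
case: Ik => [[Ek Hk]|[m [Em mP Hm]]].
  rewrite Ek In (w0 i : 0 <= real s (1%N, k)); split=> //; right.
  exists i; split=> //; first by rewrite iP.
  move=> u uk uP; have [->//|ui] := eqVneq u i.
  by rewrite Hk ?lek in uP.
rewrite Em Iw; case: ifP => [le|/negbT]; last rewrite -ltNge => /ltW le.
  split=> //; right; exists i; split=> //; first by rewrite iP.
  move=> u uk uP; have [->//|ui] := eqVneq u i.
  by apply: le_trans le; apply: Hm => //; apply: lek.
split=> //; right; exists m; split=> // u uk uP; have [->//|ui] := eqVneq u i.
by apply: Hm => //; apply: lek.
Qed.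

End Correctness.

Arguments sem : simpl never.

(** * Correctness of the greedy algorithm and of swap rounding *)

Section Correctness.
Variables (R : realType) (n : nat).
Variables (A : 'M[R]_n) (b x : 'cV[R]_n) (M : matroid n).
Implicit Types (s : state R) (P Q : routine) (v : 'I_n).
Local Notation sem := (sem A b x (indep M)).
Local Notation f := (quad_setfun A b).
Local Notation vec := (vec n).
Local Notation bitset := (bitset n).
Local Notation best_ok := (best_ok A b M).
Local Notation weight := (weight A b).

Hypothesis symA : A^T = A.
Hypothesis diagA : forall i, A i i = 0.
Hypothesis geA0 : forall i j, 0 <= A i j.
Hypothesis geb0 : forall i, 0 <= b i 0.

Lemma greedy_roundP s a w : a != 4%N -> (forall v, 0 <= w v) ->
  (forall v, real s (1%N, nat_of_ord v) = w v) ->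
  greedy_inv M w (bitset s a) (bitset s 4) -> (#|bitset s 4| < n)%N ->
  let s' := sem (greedy_round a) s in
  [/\ forall v, real s' (1%N, nat_of_ord v) = w v,
      greedy_inv M w (bitset s' a) (bitset s' 4) & #|bitset s' 4| = #|bitset s 4|.+1].
Proof.
move=> a4 w0 sw inv lt; cbv zeta.
have [||[m [rm mP mmax]] wE] := @pick_maxP R n A b x M s.
- by move=> v; rewrite sw.
- apply/existsP; apply: contraLR lt; rewrite negb_exists => /forallP H.
  have -> : bitset s 4 = [set: 'I_n] by apply/setP=> v; rewrite in_setT; apply/negPn/H.
  by rewrite cardsT card_ord ltnn.
set s1 := sem pick_max s in rm wE.
pose s2 := set_bit (set_bit s1 (4, 6)%N true) (a, 6)%N true.
have b1 c : bitset s1 c = bitset s c by rewrite sem_bitset.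
have b24 : bitset s2 4 = m |: bitset s 4.
  by rewrite /s2 bitset_neq 1?eq_sym // (bitset_setT _ (k := m)) // b1.
have b2a : bitset s2 a = m |: bitset s a.
  by rewrite /s2 (bitset_setT _ (k := m)) // bitset_neq // b1.
have mI : m \notin bitset s a by case: inv => _ /subsetP sIP _; apply: contra mP => /sIP.
have step : greedy_inv M w (if indep M (m |: bitset s a) then m |: bitset s a
                            else bitset s a) (m |: bitset s 4).
  by apply: greedy_inv_step => // u uP; rewrite -!sw; apply: mmax.
have -> : sem (greedy_round a) s = if indep M (bitset s2 a) then s2
   else set_bit s2 (a, 6)%N false by [].
rewrite b2a; case: ifP step => ind step.
  by rewrite b24 b2a cardsU1 mP; split=> // v; rewrite -sw -wE.
rewrite [bitset _ 4]bitset_neq 1?eq_sym // b24 (bitset_setF _ (k := m)) // b2a setU1K //.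
by rewrite cardsU1 mP; split=> // v; rewrite -sw -wE.
Qed.

Lemma greedyP s a : a != 4%N -> nonneg (vec s 0) ->
  max_base M (weight (vec s 0)) (bitset (sem (greedy a) s) a).
Proof.
move=> a4 y0; set w := weight (vec s 0).
have w0 v : 0 <= w v by apply: weight_ge0.
set s1 := sem (weights;; clear_bits a;; clear_bits 4)%routine s.
have E : [/\ forall v, real s1 (1%N, nat_of_ord v) = w v,
    bitset s1 a = set0 & bitset s1 4 = set0].
  rewrite /s1; split.
  - move=> v; have -> : sem (weights;; clear_bits a;; clear_bits 4)%routine s =
      sem (clear_bits a;; clear_bits 4)%routine (sem weights s) by [].
    by rewrite sem_real // weightsP.
  - have -> : sem (weights;; clear_bits a;; clear_bits 4)%routine s =
      sem (clear_bits 4) (sem (clear_bits a) (sem weights s)) by [].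
    by rewrite sem_bitset ?clear_bitsP //= !inE.
  - exact: clear_bitsP.
rewrite -[sem (greedy a) s]/(sem (For 4 (greedy_round a)) s1).
(* Every round processes one new element, so after [n] rounds all are processed and [greedy_invT]
   applies. *)
suff [H1 H2 H3] : [/\ forall v,
    real (sem (For 4 (greedy_round a)) s1) (1%N, nat_of_ord v) = w v,
    greedy_inv M w (bitset (sem (For 4 (greedy_round a)) s1) a)
                   (bitset (sem (For 4 (greedy_round a)) s1) 4)
    & #|bitset (sem (For 4 (greedy_round a)) s1) 4| = n].
  apply: greedy_invT; congr (greedy_inv M w _ _): H2.
  by apply/eqP; rewrite eqEcard subsetT H3 cardsT card_ord leqnn.
apply: (for_ind (Inv := fun k s' => [/\ forall v, real s' (1%N, nat_of_ord v) = w v,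
    greedy_inv M w (bitset s' a) (bitset s' 4) & #|bitset s' 4| = k])) => //.
  case: E => E1 E2 E3; rewrite -[bitset (set_reg _ _ _) a]/(bitset s1 a).
  rewrite -[bitset (set_reg _ _ _) 4]/(bitset s1 4) E2 E3 cards0.
  by split=> //; apply: greedy_inv0.
move=> k s' kn _ _ [H1 H2 H3]; have [|G1 G2 G3] := greedy_roundP a4 w0 H1 H2.
  by rewrite H3.
by rewrite H3 in G3.
Qed.

Lemma best_ok_sem P s : 0%N \notin regs P -> 0%N \notin bits P -> 4%N \notin reals P ->
  best_ok s -> best_ok (sem P s).
Proof. by move=> rP bP xP; rewrite /best_ok sem_reg // sem_bitset // sem_real. Qed.

Lemma charvec_swap_sum (I J : {set 'I_n}) i j : i \in I :\: J -> j \in J :\: I ->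
  charvec R (j |: (I :\ i)) + charvec R (i |: (J :\ j)) = charvec R I + charvec R J.
Proof.
move=> /setDP[iI iJ] /setDP[jJ jI].
rewrite !charvecU1 ?inE ?(negPf jI) ?(negPf iJ) ?andbF // !charvecD1 //.
by apply/colP=> v; rewrite !mxE; ring.
Qed.

Lemma setU1D1K (J : {set 'I_n}) i j : i \notin J -> j \in J ->
  (j |: (i |: (J :\ j))) :\ i = J.
Proof.
move=> iJ jJ; rewrite setUCA setU1K ?setD1K //.
Qed.

Lemma restore1P s (i j : 'I_n) : reg s 2 = i -> reg s 3 = j ->
  bitset (sem restore1 s) 1 = (i |: bitset s 1) :\ j.
Proof.
move=> ri rj.
rewrite -[sem restore1 s]/(set_bit (set_bit s (1, 2)%N true) (1, 3)%N false).
by rewrite (bitset_setF _ (k := j)) // (bitset_setT _ (k := i)).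
Qed.

Lemma restore2P s (i j : 'I_n) : reg s 2 = i -> reg s 3 = j ->
  bitset (sem restore2 s) 2 = (j |: bitset s 2) :\ i.
Proof.
move=> ri rj.
rewrite -[sem restore2 s]/(set_bit (set_bit s (2, 3)%N true) (2, 2)%N false).
by rewrite (bitset_setF _ (k := i)) // (bitset_setT _ (k := j)).
Qed.

Lemma choose_sideP s (i j : 'I_n) : reg s 2 = i -> reg s 3 = j ->
  let w := weight (charvec R (bitset s 1) + charvec R (bitset s 2)) in
  bitset (sem choose_side s) 1 =
    (if w i <= w j then bitset s 1 else (i |: bitset s 1) :\ j) /\
  bitset (sem choose_side s) 2 =
    (if w i <= w j then (j |: bitset s 2) :\ i else bitset s 2).
Proof.
move=> ri rj w; set s0 := sem (add_bits 2) (sem (add_bits 1) (sem clear_vec s)).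
set s1 := sem weights s0.
have r1 : reg s1 2 = i /\ reg s1 3 = j by rewrite !sem_reg.
have b1 c : bitset s1 c = bitset s c by rewrite !sem_bitset.
have w1 v : real s1 (1%N, nat_of_ord v) = w v.
  rewrite weightsP /s0 !add_bitsP clear_vecP add0r; congr (weight (_ + _) v).
    by rewrite !sem_bitset.
  by rewrite !sem_bitset.
have -> : sem choose_side s = if real s1 (1%N, reg s1 2) <= real s1 (1%N, reg s1 3)
  then sem restore2 s1 else sem restore1 s1 by [].
have [-> ->] := r1; rewrite !w1; case: ifP => _.
  by rewrite (restore2P (i := i) (j := j)) ?r1.1 ?r1.2 // sem_bitset // !b1.
by rewrite (restore1P (i := i) (j := j)) ?r1.1 ?r1.2 // sem_bitset // !b1.
Qed.

Lemma extendP s (i j : 'I_n) : reg s 2 = i -> reg s 3 = j ->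
  bitset (sem extend s) 3 = extend_group M (bitset s 3) i j.
Proof.
move=> ri rj; rewrite /extend_group.
have E s' : reg s' 2 = i -> reg s' 3 = j ->
    bitset (set_bit (set_bit s' (3, 3)%N true) (3, 2)%N true) 3 = i |: (j |: bitset s' 3).
  by move=> ri' rj'; rewrite (bitset_setT _ (k := i)) // (bitset_setT _ (k := j)).
set s1 := set_bit (set_bit s (3, 3)%N true) (3, 2)%N true.
set s2 := sem (clear_bits 3) s1.
have -> : sem extend s = if indep M (bitset s1 3) then s1
   else set_bit (set_bit s2 (3, 3)%N true) (3, 2)%N true by [].
rewrite [bitset s1 3]E //; case: ifP => ind; rewrite E //.
  by rewrite clear_bitsP setU0.
all: by rewrite sem_reg.
Qed.

(** Independence is all the oracle can test; for bases [I] and [J], cardinality does the rest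
    through [base_swap]. *)
Definition exchangeable (I J : {set 'I_n}) i j := [&& i \in I :\: J, j \in J :\: I,
  indep M (j |: (I :\ i)) & indep M (i |: (J :\ j))].

Lemma exchangeP s (i j : 'I_n) : reg s 2 = i -> reg s 3 = j -> best_ok s ->
  let I := bitset s 1 in let J := bitset s 2 in let U := bitset s 3 in
  i \in I :\: J -> j \in J :\: I -> indep M (extend_group M U i j) ->
  let s' := sem exchange s in best_ok s' /\
  if exchangeable I J i j then
    [/\ (bitset s' 1, bitset s' 2) = swap_bases A b I J i j,
        bitset s' 3 = extend_group M U i j, f (bitset s 0) <= f (bitset s' 0)
      & f (bitset s' 3) <= f (bitset s' 0)]
  else [/\ bitset s' 1 = I, bitset s' 2 = J, bitset s' 3 = U & bitset s' 0 = bitset s 0].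
Proof.
move=> ri rj ok I J U iIJ jJI indU; cbv zeta; rewrite /exchangeable iIJ jJI !andTb.
have /setDP[iI iJ] := iIJ; have /setDP[jJ jI] := jJI.
set s1 := sem (BitSet (1, 2)%N false;; BitSet (1, 3)%N true;;
  BitSet (2, 3)%N false;; BitSet (2, 2)%N true)%routine s.
have r1 : reg s1 2 = i /\ reg s1 3 = j by [].
have b1 : bitset s1 1 = j |: (I :\ i).
  transitivity (bitset (set_bit (set_bit s (1, 2)%N false) (1, 3)%N true) 1) => //.
  by rewrite (bitset_setT _ (k := j)) // (bitset_setF _ (k := i)).
have b2 : bitset s1 2 = i |: (J :\ j).
  transitivity (bitset (set_bit (set_bit s (2, 3)%N false) (2, 2)%N true) 2) => //.
  by rewrite (bitset_setT _ (k := i)) // (bitset_setF _ (k := j)).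
have b3 : bitset s1 3 = U by [].
have b0 : bitset s1 0 = bitset s 0 by [].
have ok1 : best_ok s1 by apply: best_ok_sem.
set s2 := sem restore2 (sem restore1 s1).
set s3 := sem (record 3) (sem extend (sem choose_side s1)).
have -> : sem exchange s = if indep M (bitset s1 1) then
   if indep M (bitset s1 2) then s3 else s2 else s2 by [].
have H2 : best_ok s2 /\ [/\ bitset s2 1 = I, bitset s2 2 = J, bitset s2 3 = U &
    bitset s2 0 = bitset s 0].
  split; first by do 2!apply: best_ok_sem => //.
  rewrite /s2; split; try by rewrite !sem_bitset.
    by rewrite sem_bitset // (restore1P (i := i) (j := j)) // b1 setU1D1K.
  rewrite (restore2P (i := i) (j := j)) ?sem_reg //.
  by rewrite sem_bitset // b2 setU1D1K.
rewrite b1 b2; case: ifP => ind1 //=; case: ifP => ind2 //.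
have [E1 E2] := choose_sideP r1.1 r1.2; set sc := sem choose_side s1 in E1 E2.
have rc : reg sc 2 = i /\ reg sc 3 = j by rewrite !sem_reg.
have E3 : bitset (sem extend sc) 3 = extend_group M U i j.
  by rewrite (extendP rc.1 rc.2) sem_bitset.
have okc : best_ok (sem extend sc) by do 2!apply: best_ok_sem => //.
have [||ok3 le0 le3] := @recordP R n A b x M (sem extend sc) 3 _ okc.
- by [].
- by rewrite E3.
split=> //; rewrite /s3 [bitset (sem (record 3) _) 3]sem_bitset // E3; split=> //.
- rewrite !(sem_bitset _ _ _ _ (P := record 3)) // !(sem_bitset _ _ _ _ (P := extend)) //.
  rewrite E1 E2 /swap_bases b1 b2 charvec_swap_sum // !setU1D1K //.
  by case: ifP.
- by have <- : bitset (sem extend sc) 0 = bitset s 0 by rewrite !sem_bitset.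
- by move: le3; rewrite E3.
Qed.

Section SwapRounding.
Variables (c : nat) (I0 J0 : {set 'I_n}) (K : R).
Hypothesis cM : min_circuit_size M c.
Hypothesis c_gt2 : (2 < c)%N.
Hypothesis pairK : forall i j, i \in I0 -> A i j <= K *
  (bil A (delta_mx i 0) (charvec R I0) + b i 0 +
   (bil A (delta_mx j 0) (charvec R I0) + b j 0) - A i j).

Local Notation diff s := (bitset s 1 :\: bitset s 2).

Definition swap_ok s :=
  best_ok s /\
  swap_inv A b M c I0 J0 K (bitset s 1) (bitset s 2) (bitset s 3) (f (bitset s 0)).

Lemma try_exchangeP s (i j : 'I_n) : reg s 2 = i -> reg s 3 = j -> swap_ok s ->
  let s' := sem try_exchange s in
  [/\ swap_ok s', f (bitset s 0) <= f (bitset s' 0), diff s' \subset diff s &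
      if exchangeable (bitset s 1) (bitset s 2) i j then is_true (i \notin diff s')
      else bitset s' 1 = bitset s 1 /\ bitset s' 2 = bitset s 2].
Proof.
move=> ri rj [ok inv]; cbv zeta.
have -> : sem try_exchange s =
    if (i \in diff s) && (j \in bitset s 2 :\: bitset s 1) then sem exchange s else s.
  (* The inner routine is generalized so that simplification does not unfold it. *)
  rewrite /try_exchange; move: exchange => Q.
  rewrite !inE -ri -rj /sem /= -/sem /addr /=.
  by do 4!case: (bit s _).
case: ifP => [/andP[iIJ jJI]|ijN]; last first.
  split=> //; case: ifP => // /and4P[iIJ jJI _ _].
  by rewrite iIJ jJI in ijN.
have [bI bJ] := swap_inv_base inv.
have iU := swap_inv_indep inv.
have ij : i != j by apply: contraTneq iIJ => ->; case/setDP: jJI => jJ _; rewrite inE jJ.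
have UP v : v \in bitset s 3 -> (v \in bitset s 1) = (v \in bitset s 2).
  by case: inv => ? ? ? ? ? _ _ _ _ _ _ _ UP *; apply: UP.
have indU : indep M (extend_group M (bitset s 3) i j).
  have iNU := agree_notin UP iIJ.
  have jNU : j \notin bitset s 3.
    by apply: (@agree_notin _ (bitset s 2) (bitset s 1)) => // v /UP.
  by case: (extend_groupP symA diagA geA0 geb0 cM c_gt2 iU iNU jNU ij).
have [ok'] := exchangeP ri rj ok iIJ jJI indU.
case: ifP => exch; last first.
  by case=> E1 E2 E3 E0; rewrite /swap_ok E1 E2 E3 E0; split.
case=> E12 E3 le0 le3; have /and4P[_ _ ind1 ind2] := exch.
have [iI iJ] := setDP iIJ; have [jJ jI] := setDP jJI.
have := swap_inv_step symA diagA geA0 geb0 cM c_gt2 pairK inv iIJ jJI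
  (base_swap bI iI jI ind1) (base_swap bJ jJ iJ ind2) le0.
rewrite -E3 => /(_ le3); rewrite -E12 => inv'.
have := swap_bases_diff A b iIJ jJI; rewrite -E12 => -[dI _].
rewrite dI; split=> //; first exact: subD1set.
by rewrite !inE eqxx.
Qed.

(** If no partner were found for [i], the bases would be unchanged throughout the loop and every [j]
    would have failed against them, contradicting symmetric exchange. *)
Lemma exchange_loopP s (i : 'I_n) : reg s 2 = i -> swap_ok s ->
  let s' := sem (For 3 try_exchange) s in
  [/\ swap_ok s', f (bitset s 0) <= f (bitset s' 0), diff s' \subset diff s &
      i \notin diff s'].
Proof.
move=> ri ok; cbv zeta; set s' := sem _ s.
have [H1 H2 H3 H4] : [/\ swap_ok s', f (bitset s 0) <= f (bitset s' 0),
  diff s' \subset diff s &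
  i \notin diff s' \/ [/\ bitset s' 1 = bitset s 1, bitset s' 2 = bitset s 2 &
    forall j : 'I_n, (j < n)%N -> ~~ exchangeable (bitset s 1) (bitset s 2) i j]].
  rewrite /s'; apply: (for_ind (Inv := fun k s' =>
    [/\ swap_ok s', f (bitset s 0) <= f (bitset s' 0), diff s' \subset diff s &
    i \notin diff s' \/ [/\ bitset s' 1 = bitset s 1, bitset s' 2 = bitset s 2 &
    forall j : 'I_n, (j < k)%N -> ~~ exchangeable (bitset s 1) (bitset s 2) i j]])) => //.
    by split=> //; right; split.
  move=> k s1 kn [Ur _ _] rk [ok1 le1 sub1 Ik]; pose j := Ordinal kn.
  have ri1 : reg s1 2 = i by rewrite Ur.
  have [ok2 le2 sub2 D] := @try_exchangeP s1 i j ri1 rk ok1.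
  set s2 := sem try_exchange s1 in ok2 le2 sub2 D *.
  split=> //; first exact: le_trans le1 le2.
    exact: subset_trans sub2 sub1.
  case: Ik => [iN|[E1 E2 Hk]]; first by left; apply: contra iN; apply: subsetP.
  rewrite E1 E2 in D; case: ifP D => exch; first by left.
  case=> F1 F2; right; split=> // l lk; have [->|lj] := eqVneq l j; first by rewrite exch.
  by apply: Hk; apply: ltnS_neq.
split=> //; case: H4 => // -[E1 E2 H].
apply/negP; rewrite E1 E2 => iIJ; case: ok => _ /swap_inv_base[bI bJ].
have [j jJI /andP[b1 b2]] := symmetric_exchange bI bJ iIJ.
case/negP: (H j (ltn_ord j)).
by rewrite /exchangeable iIJ jJI (base_indep b1) (base_indep b2).
Qed.

Lemma swap_roundingP s : swap_ok s -> let s' := sem swap_rounding s in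
  [/\ swap_ok s', f (bitset s 0) <= f (bitset s' 0) & bitset s' 1 \subset bitset s' 2].
Proof.
move=> ok; cbv zeta; set s' := sem _ s.
have [H1 H2 H3] : [/\ swap_ok s', f (bitset s 0) <= f (bitset s' 0) &
    forall i : 'I_n, (i < n)%N -> i \notin diff s'].
  rewrite /s'; apply: (for_ind (Inv := fun k s' =>
    [/\ swap_ok s', f (bitset s 0) <= f (bitset s' 0) &
    forall i : 'I_n, (i < k)%N -> i \notin diff s'])) => //.
  move=> k s1 kn _ rk [ok1 le1 Ik]; pose i := Ordinal kn.
  have [ok2 le2 sub2 iN] := @exchange_loopP s1 i rk ok1.
  set s2 := sem _ s1 in ok2 le2 sub2 iN *.
  split=> //; first exact: le_trans le1 le2.
  move=> l lk; have [->//|li] := eqVneq l i.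
  by apply: contra (subsetP sub2 l) _; apply: Ik; apply: ltnS_neq.
split=> //; apply/subsetP=> v v1; have := H3 v (ltn_ord v).
by rewrite in_setD v1 andbT negbK.
Qed.

End SwapRounding.

End Correctness.



(** * The approximation guarantee *)

Section Rounding.
Variables (R : realType) (n : nat).
Variables (A : 'M[R]_n) (b x : 'cV[R]_n) (M : matroid n).
Local Notation sem := (sem A b x (indep M)).
Local Notation f := (quad_setfun A b).
Local Notation bitset := (bitset n).
Local Notation best_ok := (best_ok A b M).
Local Notation weight := (weight A b).
Local Notation "1_ S" := (charvec R S) (at level 8, format "1_ S").

Hypothesis symA : A^T = A.
Hypothesis diagA : forall i, A i i = 0.
Hypothesis geA0 : forall i j, 0 <= A i j.
Hypothesis geb0 : forall i, 0 <= b i 0.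

Lemma roundingP (s : state R) (c : nat) (K : R) :
  nonneg x -> best_ok s -> bitset s 3 = set0 ->
  min_circuit_size M c -> (2 < c)%N -> 0 <= K ->
  (forall I i j, base M I -> i \in I -> A i j <= K *
    (bil A (delta_mx i 0) 1_I + b i 0 + (bil A (delta_mx j 0) 1_I + b j 0) - A i j)) ->
  let V := f (bitset (sem rounding s) 0) in
  exists I J, [/\ indep M (bitset (sem rounding s) 0),
      max_base M (weight x) J, max_base M (weight 1_J) I, f I <= V /\ f J <= V &
      bil A 1_I 1_J <= 4 * V + 7 * K * V /\
      bil A 1_I 1_J <= 5 * V + 2 * ((rank M)%:R / (c%:R - 2)) * V].
Proof.
move=> x0 ok0 U0 cM c2 K0 pairK; cbv zeta.
pose s1 := sem load_x s; pose s2 := sem (greedy 2) s1.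
pose s3 := sem (add_bits 2) (sem clear_vec s2); pose s4 := sem (greedy 1) s3.
pose s5 := sem (record 1) s4; pose s6 := sem (record 2) s5.
pose s7 := sem swap_rounding s6.
have v1 : vec n s1 0 = x := load_xP A b x M s.
set J := bitset s2 2; set I := bitset s4 1.
have mJ : max_base M (weight x) J.
  by rewrite -v1; apply: greedyP => //; rewrite v1.
have v3 : vec n s3 0 = 1_J by rewrite /s3 add_bitsP clear_vecP add0r sem_bitset.
have mI : max_base M (weight 1_J) I.
  by rewrite -v3; apply: greedyP => //; rewrite v3; apply: charvec_nonneg.
have J4 : bitset s4 2 = J.
  rewrite /s4 /s3 (sem_bitset _ _ _ _ (P := greedy 1)) //.
  by rewrite (sem_bitset _ _ _ _ (P := add_bits 2)) // sem_bitset.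
have ok4 : best_ok s4 by rewrite /s4 /s3 /s2 /s1; do 5!apply: best_ok_sem => //.
have [bI bJ] : base M I /\ base M J by case: mI mJ => ? _ [].
have [||ok5 _ I5] := @recordP R n A b x M s4 1 _ ok4 => //; first exact: base_indep.
rewrite -/I -/s5 in ok5 I5.
have J5 : bitset s5 2 = J by rewrite /s5 sem_bitset.
have [||ok6 le56 J6] := @recordP R n A b x M s5 2 _ ok5 => //.
  by rewrite J5; apply: base_indep.
rewrite J5 -/s6 in ok6 le56 J6.
have E6 : [/\ bitset s6 1 = I, bitset s6 2 = J & bitset s6 3 = set0].
  rewrite /s6 !(sem_bitset _ _ _ _ (P := record 2)) // J5 /s5.
  rewrite !(sem_bitset _ _ _ _ (P := record 1)) //; split=> //.
  by rewrite /s4 /s3 /s2 /s1 !sem_bitset.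
have f60 : 0 <= f (bitset s6 0) by apply: quad_setfun_ge0.
have inv6 : swap_ok A b M c I J K s6.
  by split=> //; have [-> -> ->] := E6; apply: swap_inv0.
have pairI i j := pairK I i j bI.
have [[ok7 inv7] le67 sub7] := @swap_roundingP R n A b x M
  symA diagA geA0 geb0 c I J K cM c2 pairI s6 inv6.
rewrite -/s7 in ok7 inv7 le67 sub7.
have [b7 _] := swap_inv_base inv7.
have [||[_ i8] le78 I8] := @recordP R n A b x M s7 1 _ ok7 => //; first exact: base_indep.
have E8 : sem rounding s = sem (record 1) s7 by [].
rewrite -E8 in i8 le78 I8; set V := f (bitset (sem rounding s) 0) in le78 I8 *.
have fI : f I <= V by apply: le_trans I5 _; apply: le_trans le56 _; apply: le_trans le67 _.
have fJ : f J <= V by apply: le_trans J6 _; apply: le_trans le67 _.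
exists I, J; split=> //.
apply: (@swap_inv_final _ _ _ _ _ _ _ _ _ symA geA0 geb0 c2 bI K0
  (bitset s7 1) (bitset s7 2) (bitset s7 3)) => //.
exact: swap_inv_le le78 inv7.
Qed.

Lemma rounding_bounds (s : state R) (c : nat) (sigma : R) :
  best_ok s -> bitset s 3 = set0 ->
  one_sided_smooth sigma (multilinear f) -> matroid_polytope R M x ->
  min_circuit_size M c -> (2 < c)%N ->
  let V := f (bitset (sem rounding s) 0) in
  [/\ indep M (bitset (sem rounding s) 0),
      multilinear f x <= 28 * ((rank M)%:R / (c%:R - 2)) * V &
      multilinear f x <= 28 * (1 + sigma / (rank M)%:R) * V].
Proof.
move=> ok U0 smF xP cM c2; cbv zeta.
set r := (rank M)%:R; set rho := r / _.
have r2 : (1 < rank M)%N by rewrite -ltnS; exact: leq_trans c2 (circuit_size_le_rank cM).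
have c0 : 0 < c%:R - 2 :> R by rewrite subr_gt0 ltr_nat.
have r1 : 2 <= r by rewrite ler_nat.
have rho1 : 1 <= rho.
  rewrite ler_pdivlMr // mul1r lerBlDr -natrD ler_nat.
  by apply: leq_trans (circuit_size_le_rank cM) _; rewrite addn2.
have x0 := polytope_nonneg xP.
(* This is the constant of [smooth_pair] for a base; for negative [sigma] the matrix vanishes and 0
   will do. *)
pose K := if sigma < 0 then 0 else sigma * (2 / (r - 1)).
have K0 : 0 <= K.
  rewrite /K; case: ltP => // s0; apply: mulr_ge0 => //.
  by apply: divr_ge0 => //; lra.
have [|I [J [iV [bJ mJ] [bI mI] [fI fJ] [B1 B2]]]] :=
    @roundingP s c K x0 ok U0 cM c2 K0.
  move=> I i j bI iI; rewrite /K; case: ltP => s0.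
    have [A0 _] := smooth_lt0 symA diagA geA0 geb0 smF s0.
    by rewrite A0 mul0r.
  have := smooth_pair symA diagA smF (I := I) j _ iI.
  by rewrite (card_base bI); apply.
move: iV fI fJ B1 B2; set V := f (bitset _ 0) => iV fI fJ B1 B2.
have V0 : 0 <= V by apply: quad_setfun_ge0.
(* Optimality of [J] bounds [bil x x + 2 lin x], which is [2 F(x)], by [bil 1_J x + 2 lin 1_J];
   optimality of [I] bounds [bil x 1_J + 2 lin x] by [bil 1_I 1_J + 2 lin 1_I]. *)
have Fle : multilinear f x <= bil A 1_I 1_J + 4 * V.
  have := max_base_polytope (conj bJ mJ) (fun v => weight_ge0 geA0 geb0 v x0) xP.
  have := max_base_polytope (conj bI mI)
    (fun v => weight_ge0 geA0 geb0 v (@charvec_nonneg R n J)) xP.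
  rewrite !sum_weight !sum_weight_in multilinearE // (bilC symA 1_J x).
  rewrite !quad_setfunE in fI fJ.
  have := bil_ge0 geA0 (@charvec_nonneg R n I) (@charvec_nonneg R n I).
  have := bil_ge0 geA0 (@charvec_nonneg R n J) (@charvec_nonneg R n J).
  have := bil_ge0 geA0 x0 x0; have := lin_ge0 geb0 x0.
  by lra.
have rhoV : V <= rho * V by rewrite -{1}[V]mul1r ler_wpM2r.
rewrite -/r -/rho in B2; split=> //; first by lra.
(* For negative [sigma] the factor [1 + sigma / r] may be negative, but both [F] and [V] are then
   0. *)
have [s0|s0] := ltP sigma 0.
  have [A0 b0] := smooth_lt0 symA diagA geA0 geb0 smF s0.
  have bil0 u : bil A u u = 0.
    by rewrite bilE big1 // => i _; rewrite big1 ?mulr0 // => j _; rewrite A0 mul0r.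
  have lin0 u : lin b u = 0 by rewrite linE big1 // => i _; rewrite b0 mul0r.
  by rewrite multilinearE // /V quad_setfunE !bil0 !lin0 mulr0 addr0 mulr0.
(* As [r >= 2], [2 / (r - 1) <= 4 / r]. The total [8 * V + 7 * K * V] then gives the constant 28. *)
have KV : K * V <= 4 * (sigma / r) * V.
  apply: ler_wpM2r => //; rewrite /K ltNge s0 /= [leRHS]mulrCA; apply: ler_wpM2l => //.
  rewrite ler_pdivlMr; last by lra.
  by rewrite mulrAC ler_pdivrMr; lra.
by lra.
Qed.

End Rounding.

(** The two bounds balance at [r = Num.sqrt sigma]: below it [r / q <= r] is small, above it
    [sigma / r] is at most [Num.sqrt sigma]. *)
Lemma min_ratio_le_sqrt (R : realType) (r q sigma : R) : 0 < r -> 1 <= q -> 1 <= sigma ->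
  Num.min (r / q) (1 + sigma / r) <= 2 * Num.sqrt sigma.
Proof.
move=> r0 q1 s1; set t := Num.sqrt sigma.
have t1 : 1 <= t by rewrite -sqrtr1 ler_wsqrtr.
have st : sigma = t * t by rewrite -expr2 sqr_sqrtr //; lra.
rewrite ge_min; have [rt|/ltW tr] := leP r t; apply/orP; [left|right].
  rewrite ler_pdivrMr; last by lra.
  by nra.
suff : sigma / r <= t by lra.
by rewrite ler_pdivrMr // st; apply: ler_wpM2l => //; lra.
Qed.

Theorem theorem3 (R : realType) :
  exists (P : prog) (T : {poly nat}) (C1 C2 : R),
  forall (n : nat) (A : 'M[R]_n) (b : 'cV[R]_n) (sigma : R)
         (M : matroid n) (c : nat) (x : 'cV[R]_n),
    let f := quad_setfun A b in
    let F := multilinear f in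
    let r := rank M in
    let ratio := Num.min (r%:R / (c%:R - 2)) (1 + sigma / r%:R) in
    A^T = A ->
    (forall i, A i i = 0) ->
    (forall i j, 0 <= A i j) ->
    (forall i, 0 <= b i 0) ->
    one_sided_smooth sigma F ->
    min_circuit_size M c ->
    (2 < c)%N ->
    matroid_polytope R M x ->
    exists I : {set 'I_n},
      [/\ outputs_within A b x (indep M) P T.[n] I,
          indep M I,
          matroid_polytope R M (charvec R I),
          F x <= C1 * ratio * f I
        & 1 <= sigma -> C1 * ratio * f I <= C2 * Num.sqrt sigma * f I].
Proof.
(* The first instruction stores [n] in register 1, the bound of all loops, and costs the extra 1.
   The constant 56 is 28 times the 2 of [min_ratio_le_sqrt]. *)
exists (Seq (Instr (RegSize 1)) (compile rounding)), (1 + cost rounding), 28, 56.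
move=> n A b sigma M c x f F r ratio symA diagA geA0 geb0 smF cM c2 xP.
pose s0 := set_reg (init_state R) 1 n.
have bs0 a : bitset n s0 a = set0 by apply/setP=> v; rewrite !inE.
have ok : best_ok A b M s0.
  by rewrite /best_ok bs0 quad_setfun0 mulr0; split=> //; apply: indep0.
have [iI B1 B2] := @rounding_bounds R n A b x M symA diagA geA0 geb0 s0 c sigma
  ok (bs0 3%N) smF xP cM c2.
exists (bitset n (sem A b x (indep M) rounding s0) 0); split=> //.
- have [t run_t tP] := @compile_run R n A b x (indep M) rounding s0 isT isT erefl.
  exists (sem A b x (indep M) rounding s0), (1 + t)%N; split=> //.
    by apply: (RunSeq _ run_t); apply: (RunInstr _ _ _ _ (RegSize 1)).
  by rewrite hornerD hornerC leq_add2l.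
- exact: charvec_polytope.
- by rewrite /ratio /Num.min; case: ifP.
move=> s1; apply: ler_wpM2r; first exact: quad_setfun_ge0.
suff : ratio <= 2 * Num.sqrt sigma by lra.
apply: min_ratio_le_sqrt => //.
  by rewrite ltr0n -ltnS; exact: leq_trans (ltnW c2) (circuit_size_le_rank cM).
have : 3%:R <= c%:R :> R by rewrite ler_nat.
by lra.
Qed.
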